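(* Assume the linear model and the moment conditions (i)–(ii) described in the context, with parameters $A_0>0$, $\delta\ge 0$ and $\upsilon_{2+\delta}$. There exist positive constants $c_3,c_4,c_5$ depending only on $A_0$ such that the following holds. For any $t>0$ and $v\ge \upsilon_{2+\delta}^{1/(2+\delta)}$, the Huber estimator $\hat{\boldsymbol\theta}_\tau$ with $\tau=v\left(\frac{n}{d+t}\right)^{1/(2+\delta)}$ satisfies, with probability at least $1-3e^{-t}$, $$\left|\mathcal L_\tau(\boldsymbol\theta^* )-\mathcal L_\tau(\hat{\boldsymbol\theta}_\tau)-\frac12\left\|\frac1{\sqrt n}\sum_{i=1}^n\ell_\tau'(\varepsilon_i)\boldsymbol Z_i\right\|_2^2\right|\le c_4v^2\frac{(d+t)^{3/2}}{\sqrt n}$$ and $$\left|\sqrt{2\{\mathcal L_\tau(\boldsymbol\theta^* )-\mathcal L_\tau(\hat{\boldsymbol\theta}_\tau)\}}-\left\|\frac1{\sqrt n}\sum_{i=1}^n\ell_\tau'(\varepsilon_i)\boldsymbol Z_i\right\|_2\right|\le c_5v\frac{d+t}{\sqrt n}$$ as long as $n\ge c_3(d+t)$.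
   Context: Model: $Y=\boldsymbol X^{\top}\boldsymbol\theta^*+\varepsilon$ with $Y\in\mathbb R$, $\boldsymbol X\in\mathbb R^d$ random, $\boldsymbol\theta^*\in\mathbb R^d$; $(Y_1,\boldsymbol X_1),\ldots,(Y_n,\boldsymbol X_n)$ are i.i.d. copies of $(Y,\boldsymbol X)$ and $\varepsilon_i=Y_i-\boldsymbol X_i^{\top}\boldsymbol\theta^*$. (An intercept is accommodated by taking the first coordinate of $\boldsymbol X_i$ to be $1$.) Put $\boldsymbol\Sigma=\mathbb E(\boldsymbol X\boldsymbol X^{\top})$, $\boldsymbol Z=\boldsymbol\Sigma^{-1/2}\boldsymbol X$, $\boldsymbol Z_i=\boldsymbol\Sigma^{-1/2}\boldsymbol X_i$. Moment conditions: (i) $\boldsymbol\Sigma$ is positive definite and there is a constant $A_0>0$ such that $\mathbb P(|\langle\boldsymbol u,\boldsymbol Z\rangle|\ge A_0 t)\le 2\exp(-t^2)$ for all unit vectors $\boldsymbol u\in\mathbb R^d$ and all $t\ge 0$. (ii) $\mathbb E(\varepsilon|\boldsymbol X)=0$, $\mathbb E(\varepsilon^2|\boldsymbol X)=\sigma^2$ and $\mathbb E(|\varepsilon|^{2+\delta}|\boldsymbol X)\le\upsilon_{2+\delta}$ almost surely for some $\delta\ge 0$. Huber loss with parameter $\tau>0$: $\ell_\tau(u)=u^2/2$ if $|u|\le\tau$ and $\ell_\tau(u)=\tau|u|-\tau^2/2$ if $|u|>\tau$; thus $\ell_\tau'(u)=\mathrm{sign}(u)\min(|u|,\tau)$. $\mathcal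 L_\tau(\boldsymbol\theta)=\sum_{i=1}^n\ell_\tau(Y_i-\boldsymbol X_i^{\top}\boldsymbol\theta)$ and the Huber estimator $\hat{\boldsymbol\theta}_\tau$ is a minimizer of $\mathcal L_\tau$ over $\mathbb R^d$.
   Formalization: The constants c_3, c_4, c_5 are allowed to depend on δ as well as A_0; independence of δ over all δ≥0 is false (d=1, X=1, ε=±v with equal probability, δ large relative to n, so that τ is close to v). *)

(* Defs.v *)
From HB Require Import structures.
From mathcomp Require Import all_boot all_order all_algebra.
From mathcomp Require Import all_classical all_reals all_analysis.

Set Implicit Arguments.
Unset Strict Implicit.
Unset Printing Implicit Defensive.

Import Order.TTheory GRing.Theory Num.Theory.
Import numFieldNormedType.Exports.

Local Open Scope classical_set_scope.
Local Open Scope ring_scope.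

Section LinearAlgebra.
Context {R : realType}.

Definition dot d (x y : 'cV[R]_d) : R := \sum_(i < d) x i 0 * y i 0.

(* The library norm on matrices is the sup norm, so the Euclidean norm is
   introduced separately. *)
Definition l2norm d (x : 'cV[R]_d) : R := Num.sqrt (dot x x).

Definition posdefmx d (A : 'M[R]_d) : Prop :=
  A^T = A /\ forall u : 'cV[R]_d, u != 0 -> 0 < dot u (A *m u).

(* A ^ (-1/2): a positive definite matrix has a unique positive definite
   inverse square root, so the choice made by get is immaterial. *)
Definition inv_sqrtmx d (A : 'M[R]_d) : 'M[R]_d :=
  get [set S : 'M[R]_d | posdefmx S /\ S *m S = invmx A].

Definition vec d (x : d.-tuple R) : 'cV[R]_d := \col_(i < d) tnth x i.

End LinearAlgebra.

Section Probability.
Local Open Scope ereal_scope.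
Context {R : realType} {dT dS : measure_display}.
Context {T : measurableType dT} {S : measurableType dS}.
Variable P : probability T R.

Definition mutually_independent n (V : 'I_n -> T -> S) : Prop :=
  forall (J : {set 'I_n}) (B : 'I_n -> set S), (forall i, measurable (B i)) ->
  P (\bigcap_(i in [set` J]) (V i @^-1` B i)) =
  \prod_(i in J) P (V i @^-1` B i).

Definition identically_distributed (V W : T -> S) : Prop :=
  forall B : set S, measurable B -> P (V @^-1` B) = P (W @^-1` B).

Definition iid_copies n (V : 'I_n -> T -> S) (W : T -> S) : Prop :=
  mutually_independent V /\ forall i, identically_distributed (V i) W.

(* g is a version of the conditional expectation E(f | X). *)
Definition is_cond_expectation (X : T -> S) (f g : T -> R) : Prop :=
  [/\ P.-integrable setT (EFin \o f),
      P.-integrable setT (EFin \o g),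
      forall B : set R, measurable B ->
        g_sigma_algebra_preimage X (g @^-1` B) &
      forall A : set T, g_sigma_algebra_preimage X A ->
        \int[P]_(w in A) (f w)%:E = \int[P]_(w in A) (g w)%:E].

End Probability.

Section HuberRegression.
Context {R : realType}.

Definition huber (tau u : R) : R :=
  if `|u| <= tau then u ^+ 2 / 2 else tau * `|u| - tau ^+ 2 / 2.

Definition huber_objective n d (tau : R) (x : 'I_n -> 'cV[R]_d) (y : 'I_n -> R)
    (theta : 'cV[R]_d) : R :=
  \sum_(i < n) huber tau (y i - dot (x i) theta).

Definition huber_estimate n d (tau : R) (x : 'I_n -> 'cV[R]_d) (y : 'I_n -> R)
    (theta_hat : 'cV[R]_d) : Prop :=
  forall theta : 'cV[R]_d,
    huber_objective tau x y theta_hat <= huber_objective tau x y theta.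

Context {dT : measure_display} {T : measurableType dT} (P : probability T R).
Context {d : nat}.
Implicit Types (X : {RV P >-> d.-tuple (measurableTypeR R)}) (Y : {RV P >-> R}).

Definition residual X Y (theta : 'cV[R]_d) (w : T) : R :=
  Y w - dot (vec (X w)) theta.

(* fine sends an infinite second moment to 0; no separate integrability
   hypothesis is needed below, as a positive definite matrix has a positive
   diagonal. *)
Definition second_moment X : 'M[R]_d :=
  \matrix_(i, j) fine (\int[P]_w (tnth (X w) i * tnth (X w) j)%:E)%E.

(* Sigma^(-1/2) x where Sigma is the second moment matrix of X. *)
Definition whiten X (x : d.-tuple R) : 'cV[R]_d :=
  inv_sqrtmx (second_moment X) *m vec x.

Definition subgaussian_design X (A0 : R) : Prop :=
  posdefmx (second_moment X) /\
  forall (u : 'cV[R]_d) (t : R), l2norm u = 1 -> 0 <= t ->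
  let tail := [set w | A0 * t <= `|dot u (whiten X (X w))|] in
  (P tail <= (2 * expR (- t ^+ 2))%:E)%E.

Definition noise_moments X Y (theta : 'cV[R]_d) (sigma delta ups : R) : Prop :=
  let eps := residual X Y theta in
  [/\ is_cond_expectation P X eps (cst 0),
      is_cond_expectation P X (fun w => eps w ^+ 2) (cst (sigma ^+ 2)) &
      exists g : T -> R,
        is_cond_expectation P X (fun w => `|eps w| `^ (2 + delta)) g /\
        {ae P, forall w, g w <= ups}].

(* || n^(-1/2) sum_i l_tau'(eps_i) Z_i ||_2 *)
Definition score_norm n (tau : R) (eps : 'I_n -> R) (z : 'I_n -> 'cV[R]_d) : R :=
  l2norm ((Num.sqrt n%:R)^-1 *: \sum_(i < n) derive1 (huber tau) (eps i) *: z i).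

End HuberRegression.

(* Main.v *)
Require Import Defs.
From HB Require Import structures.
From mathcomp Require Import all_boot all_order all_algebra.
From mathcomp Require Import all_classical all_reals all_analysis.
From mathcomp Require Import measurable_realfun spectral complex ring lra zify.

Set Implicit Arguments.
Unset Strict Implicit.
Unset Printing Implicit Defensive.

Import Order.TTheory GRing.Theory Num.Theory.
Import numFieldNormedType.Exports.

Local Open Scope classical_set_scope.
Local Open Scope ring_scope.

(** Put w = Sigma^(1/2) (theta - theta_star), so that the residuals at theta are
    eps_i - <Z_i, w>, and let F(w) be the decrease of the Huber loss from
    theta_star to theta.  The excess is the maximum of F.  With S the sum of the
    huber_score(eps_i) Z_i, a second order expansion of the loss gives

      <w, S> - (1/2) sum <Z_i, w>^2 <= F(w)
                      <= <w, S> - (1/2) sum <Z_i, w>^2 + (1/2) B(w),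

    where B(w) collects the <Z_i, w>^2 over the observations for which |eps_i|
    or |<Z_i, w>| exceeds tau / 2, since the loss is quadratic elsewhere.  Write
    q = sqrt ((d + t) / n).  Three facts hold with high probability:
    - |S| is at most a constant times v n q;
    - sum <Z_i, u>^2 = n |u|^2 (1 + O(q)) uniformly in u;
    - B(w) = |w|^2 O(n q) uniformly over the ball of radius r, of order v q.
    Hence F lies on this ball between the quadratics <w, S> - (n/2)(1 +- k)|w|^2
    with k = O(q), and F, being concave, cannot exceed 0 outside of it.  The
    maxima of these quadratics are (xi^2 / 2) / (1 +- k) with xi = |S| / sqrt n,
    so that 2 excess = xi^2 (1 + O(q)) (excess_sandwich), and both estimates
    follow from xi = O(v sqrt (d + t)) (wilks_expansion).

    The three facts come from one scheme.  Each of them bounds a convex function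
    of u, or a bilinear form, by its maximum over a finite set of at most
    2^(18 d) lattice points of the ball of radius 2 (midpoint_convex_net,
    quadratic_net, lattice_net).  For one lattice point, the exponential moment
    of a single observation is at most exp (C (d + t) / n) (score_mgf, quad_mgf,
    defect_mgf); here tau enters, as it makes tau q / v at most 1 while the bias
    and the tail probability caused by truncation remain of order (d + t) / n.
    Independence turns this into exp (C (d + t)) for the sum, and Markov's
    inequality with a union bound over the net conclude (net_chernoff).

    As the minimizer is an arbitrary function of the sample point, measurability
    of the final event is obtained from that of the minimal value
    (measurable_minimal_objective), and the whitening matrix is shown to exist by
    the spectral theorem (posdefmx_inv_sqrt). *)

(** * Euclidean geometry of column vectors *)

Section Dot.
Context {R : realType} {d : nat}.
Implicit Types (u v w : 'cV[R]_d) (A : 'M[R]_d).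

Lemma dotE u v : dot u v = (u^T *m v) 0 0.
Proof. by rewrite mxE; apply: eq_bigr => i _; rewrite mxE. Qed.

Lemma dotC u v : dot u v = dot v u.
Proof. by apply: eq_bigr => i _; rewrite mulrC. Qed.

Lemma dotDl u v w : dot (u + v) w = dot u w + dot v w.
Proof. by rewrite -big_split; apply: eq_bigr => i _; rewrite mxE mulrDl. Qed.

Lemma dotZl a u w : dot (a *: u) w = a * dot u w.
Proof. by rewrite mulr_sumr; apply: eq_bigr => i _; rewrite mxE mulrA. Qed.

Lemma dotDr u v w : dot w (u + v) = dot w u + dot w v.
Proof. by rewrite !(dotC w) dotDl. Qed.

Lemma dotZr a u w : dot w (a *: u) = a * dot w u.
Proof. by rewrite !(dotC w) dotZl. Qed.

Lemma dotNl u w : dot (- u) w = - dot u w.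
Proof. by rewrite -scaleN1r dotZl mulN1r. Qed.

Lemma dotBl u v w : dot (u - v) w = dot u w - dot v w.
Proof. by rewrite dotDl dotNl. Qed.

Lemma dotBr u v w : dot w (u - v) = dot w u - dot w v.
Proof. by rewrite !(dotC w) dotBl. Qed.

Lemma dot0l u : dot 0 u = 0.
Proof. by rewrite -(scale0r 0) dotZl mul0r. Qed.

Lemma dot_sumr (I : Type) (s : seq I) (F : I -> 'cV[R]_d) u :
  dot u (\sum_(i <- s) F i) = \sum_(i <- s) dot u (F i).
Proof.
elim: s => [|i s IH]; first by rewrite !big_nil dotC dot0l.
by rewrite !big_cons dotDr IH.
Qed.

Lemma dot_mulmx A u v : dot (A *m u) v = dot u (A^T *m v).
Proof. by rewrite !dotE trmx_mul mulmxA. Qed.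

Lemma dot_ge0 u : 0 <= dot u u.
Proof. by apply: sumr_ge0 => i _; rewrite -expr2 sqr_ge0. Qed.

Lemma dot_gt0 u : u != 0 -> 0 < dot u u.
Proof.
move=> u0; rewrite lt_neqAle dot_ge0 andbT eq_sym.
apply: contra u0; rewrite /dot psumr_eq0; last first.
  by move=> i _; rewrite -expr2 sqr_ge0.
move=> /allP u0; apply/eqP/matrixP => i j; rewrite (ord1 j) mxE.
by have := u0 i (mem_index_enum i); rewrite /= mulf_eq0 orbb => /eqP.
Qed.

Lemma sqr_l2norm u : l2norm u ^+ 2 = dot u u.
Proof. by rewrite sqr_sqrtr ?dot_ge0. Qed.

Lemma l2norm_ge0 u : 0 <= l2norm u.
Proof. exact: sqrtr_ge0. Qed.

Lemma l2normZ a u : l2norm (a *: u) = `|a| * l2norm u.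
Proof.
by rewrite /l2norm dotZl dotZr mulrA -expr2 sqrtrM ?sqr_ge0// sqrtr_sqr.
Qed.

Lemma cauchy_schwarz u v : dot u v <= l2norm u * l2norm v.
Proof.
have [->|u0] := eqVneq u 0.
  by rewrite dot0l mulr_ge0 ?l2norm_ge0.
have [->|v0] := eqVneq v 0.
  by rewrite dotC dot0l mulr_ge0 ?l2norm_ge0.
have pos (w : 'cV[R]_d) : w != 0 -> 0 < l2norm w.
  by move=> w0; rewrite sqrtr_gt0 dot_gt0.
have /pos Pu := u0; have /pos Pv := v0.
have := dot_ge0 (l2norm v *: u - l2norm u *: v).
rewrite dotBl !dotBr !dotZl !dotZr -!sqr_l2norm (dotC v u) => H.
have Puv : 0 < l2norm u * l2norm v by apply: mulr_gt0.
rewrite -(ler_pM2l Puv); nra.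
Qed.

End Dot.

(** * Inverse square root of a positive definite matrix *)

Section InverseSquareRoot.
Context {R : realType}.

Lemma posdefmx_unit d (A : 'M[R]_d) : posdefmx A -> A \in unitmx.
Proof.
move=> [_ pdA]; rewrite -row_free_unit -kermx_eq0; apply/eqP.
apply/row_matrixP => i; apply/eqP; rewrite row0; apply: contraT => r0.
have t0 : (row i (kermx A))^T != 0.
  by apply: contra r0 => /eqP t0; rewrite -[row _ _]trmxK t0 trmx0.
have := pdA _ t0; rewrite dotE trmxK mulmxA -row_mul mulmx_ker row0 mul0mx.
by rewrite mxE ltxx.
Qed.

Lemma posdefmx_eigenvalue d (A : 'M[R]_d) a :
  posdefmx A -> eigenvalue A a -> 0 < a.
Proof.
move=> [symA pdA] /eigenvalueP[v vA v0].
have t0 : v^T != 0 by apply: contra v0 => /eqP t0; rewrite -[v]trmxK t0 trmx0.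
have := pdA _ t0; rewrite -[A]symA -trmx_mul vA -[a *: v]trmxK trmxK linearZ /=.
by rewrite dotZr pmulr_lgt0 // dot_gt0.
Qed.

Lemma poly_interpolation (F : fieldType) (s : seq F) (f : F -> F) :
  exists q : {poly F}, forall x, x \in s -> q.[x] = f x.
Proof.
elim: s => [|a s [q Hq]]; first by exists 0.
pose p := \prod_(b <- s) ('X - b%:P).
have [as_|as_] := boolP (a \in s).
  by exists q => x; rewrite inE => /predU1P[->|]; apply: Hq.
exists (q + ((f a - q.[a]) / p.[a]) *: p) => x.
rewrite inE hornerD hornerZ => /predU1P[->|xs].
  rewrite divfK; first by rewrite addrC subrK.
  by rewrite -[_ == 0]/(root p a) root_prod_XsubC.
have /rootP -> : root p x by rewrite root_prod_XsubC.
by rewrite mulr0 addr0 Hq.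
Qed.

Lemma horner_mx_sym n (A : 'M[R]_n.+1) (q : {poly R}) :
  A^T = A -> (horner_mx A q)^T = horner_mx A q.
Proof.
move=> symA; elim/poly_ind: q => [|q c IH]; first by rewrite !rmorph0 trmx0.
rewrite !rmorphD !rmorphM /= horner_mx_X horner_mx_C linearD /= tr_scalar_mx.
by rewrite -mulmxE trmx_mul IH symA; congr (_ + _); apply: comm_mx_horner.
Qed.

Local Open Scope complex_scope.

(** The root is taken as a polynomial in A interpolating x^(-1/4) at the
    eigenvalues: being a real polynomial in A it is real and symmetric, although
    the spectral theorem diagonalizes A only over the complex numbers. *)
Lemma posdefmx_fourth_root n (A : 'M[R]_n.+1) : posdefmx A ->
  exists T : 'M[R]_n.+1, T^T = T /\ T *m T *m (T *m T) *m A = 1%:M.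
Proof.
move=> pdA; have symA := pdA.1.
pose C := map_mx (real_complex R) A.
have hermC : C \is hermsymmx.
  apply: realsym_hermsym.
    by apply/is_hermitianmxP; rewrite expr0 scale1r map_mx_id // map_trmx symA.
  by apply/mxOverP => i j; rewrite mxE complex_real.
have /orthomx_spectralP := hermitian_normalmx hermC.
have /mxOverP Dreal := hermitian_spectral_diag_real hermC.
set P := spectralmx C; set D := spectral_diag C => CE.
have Punit : P \in unitmx by apply: spectral_unit.
pose l j := complex.Re (D 0 j).
have DE j : D 0 j = (l j)%:C by rewrite RRe_real.
have l_gt0 j : 0 < l j.
  apply: (posdefmx_eigenvalue pdA); rewrite eigenvalue_root_char.
  rewrite -(fmorph_root (real_complex R)) map_char_poly -eigenvalue_root_char.
  apply/eigenvalueP; exists (row j P).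
    rewrite -/C CE -row_mul -!mulmxA mulKVmx // mul_diag_mx.
    by apply/rowP => k; rewrite !mxE DE.
  by have := Punit; rewrite -row_free_unit => /row_freeP[B PB];
    apply/eqP => rP; have := congr1 (row j) PB; rewrite row_mul rP mul0mx;
    move=> /matrixP/(_ 0 j); rewrite !mxE eqxx => /eqP; rewrite eq_sym oner_eq0.
have [q Hq] := poly_interpolation [seq l j | j <- enum 'I_n.+1]
  (fun x => Num.sqrt (Num.sqrt x^-1)).
have ql j : q.[l j] ^+ 4 * l j = 1.
  rewrite Hq; last by apply: map_f; rewrite mem_enum.
  rewrite (exprM _ 2 2) !sqr_sqrtr ?sqrtr_ge0 ?invr_ge0 ?(ltW (l_gt0 j)) //.
  by rewrite mulVf // gt_eqF.
exists (horner_mx A q); split; first exact: horner_mx_sym.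
have -> : horner_mx A q *m horner_mx A q *m (horner_mx A q *m horner_mx A q)
    *m A = horner_mx A (q * q * (q * q) * 'X).
  by rewrite !rmorphM /= horner_mx_X.
apply: (@map_mx_inj _ _ (real_complex R)).
rewrite map_horner_mx -/C CE map_mx1 horner_mx_uconjC // horner_mx_diag.
suff -> : map_mx (horner (map_poly (real_complex R) (q * q * (q * q) * 'X))) D
    = const_mx 1 by rewrite diag_const_mx mulmx1 mulVmx.
apply/rowP => j; rewrite !mxE DE horner_map !hornerE /=.
rewrite -[RHS](rmorph1 (real_complex R)).
by rewrite -(ql j); congr (_%:C); ring.
Qed.

(** The square root is the square of the symmetric fourth root, which makes it
    positive definite at once. *)
Lemma posdefmx_inv_sqrt d (A : 'M[R]_d) : posdefmx A ->
  exists S : 'M[R]_d, posdefmx S /\ S *m S = invmx A.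
Proof.
case: d A => [|n] A pdA.
  exists A; split=> //; apply/matrixP; case=> //.
have [T [symT T4]] := posdefmx_fourth_root pdA.
have Tunit : T \in unitmx.
  by move: T4; rewrite -!mulmxA => /mulmx1_unit[].
have T4A : T *m T *m (T *m T) = invmx A.
  by rewrite -[RHS]mul1mx -T4 mulmxK // posdefmx_unit.
exists (T *m T); split=> //; split; first by rewrite trmx_mul symT.
move=> u u0; rewrite -mulmxA -{1}symT -dot_mulmx; apply: dot_gt0.
by apply: contra u0 => /eqP Tu; rewrite -[u](mulKmx Tunit) Tu mulmx0.
Qed.

Lemma inv_sqrtmxP d (A : 'M[R]_d) : posdefmx A ->
  posdefmx (inv_sqrtmx A) /\ inv_sqrtmx A *m inv_sqrtmx A = invmx A.
Proof.
move=> /posdefmx_inv_sqrt exS.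
exact: (@getPex _ [set S | posdefmx S /\ S *m S = invmx A] exS).
Qed.

Lemma inv_sqrtmx_conj d (A : 'M[R]_d) : posdefmx A ->
  inv_sqrtmx A *m A *m inv_sqrtmx A = 1%:M.
Proof.
move=> pdA; have [pdS SS] := inv_sqrtmxP pdA; set S := inv_sqrtmx A in pdS SS *.
have Su := posdefmx_unit pdS; have Au := posdefmx_unit pdA.
apply: (can_inj (mulKmx Su)); rewrite mulmx1 !mulmxA SS mulVmx //.
by rewrite mul1mx.
Qed.

End InverseSquareRoot.

(** * The Huber loss *)

Section Huber.
Context {R : realType}.
Implicit Types tau : R.

Definition huber_score (tau u : R) : R := Num.max (- tau) (Num.min u tau).

(** The three regimes of the loss; at the boundary points the regimes agree. *)
Variant huber_spec tau (u : R) : R -> R -> Type :=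
| HuberMid of - tau <= u <= tau : huber_spec tau u (u ^+ 2 / 2) u
| HuberHigh of tau <= u : huber_spec tau u (tau * u - tau ^+ 2 / 2) tau
| HuberLow of u <= - tau : huber_spec tau u (- tau * u - tau ^+ 2 / 2) (- tau).

Lemma huberP tau (tau_gt0 : 0 < tau) (u : R) :
  huber_spec tau u (huber tau u) (huber_score tau u).
Proof.
rewrite /huber /huber_score ler_norml.
have [u1|u1] := ltrP u (- tau).
  have utau : u <= tau by lra.
  have tauu : u <= - tau by lra.
  rewrite (min_idPl utau) (max_idPl tauu).
  rewrite ltr0_norm; [rewrite mulrN -mulNr; constructor|]; lra.
have [u2|u2] := lerP u tau.
  rewrite (max_idPr u1).
  by constructor; rewrite u1.
have tt : - tau <= tau by lra.
rewrite (max_idPr tt).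
by rewrite gtr0_norm; [constructor|]; lra.
Qed.

(** The derivative of the loss is nondecreasing and 1-Lipschitz.  This one
    estimate gives the convexity, the Lipschitz bound and the derivative of the
    loss, without any discussion of the gluing points. *)
Lemma huber_taylor tau (tau_gt0 : 0 < tau) (u h : R) :
  0 <= huber tau (u + h) - huber tau u - huber_score tau u * h <= h ^+ 2 / 2.
Proof.
have [w ->] : exists w, h = w - u by exists (u + h); ring.
rewrite [u + _]addrC subrK.
case: (huberP tau_gt0 u) => [/andP[u1 u2]|u1|u1];
  case: (huberP tau_gt0 w) => [/andP[w1 w2]|w1|w1]; apply/andP; split;
  rewrite -subr_ge0.
all: have := sqr_ge0 (w - u); have := sqr_ge0 (w - tau); have := sqr_ge0 (w + tau).
all: have := sqr_ge0 (u - tau); have := sqr_ge0 (u + tau); nra.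
Qed.

Lemma huber_score_bound tau (tau_gt0 : 0 < tau) (u : R) : `|huber_score tau u| <= tau.
Proof.
by rewrite ler_norml; case: (huberP tau_gt0 u) => ?; apply/andP; split; lra.
Qed.

Lemma huber_score_le tau (tau_gt0 : 0 < tau) (u : R) : `|huber_score tau u| <= `|u|.
Proof.
case: (huberP tau_gt0 u) => [//|u1|u1].
  by rewrite !gtr0_norm //; lra.
by rewrite !ler0_norm //; lra.
Qed.

Lemma huber_lipschitz tau (tau_gt0 : 0 < tau) (u w : R) :
  `|huber tau u - huber tau w| <= tau * `|u - w|.
Proof.
have key x y : huber tau x - huber tau y <= tau * `|x - y|.
  have /andP[H _] := huber_taylor tau_gt0 x (y - x); rewrite [x + _]addrC subrK in H.
  apply: (@le_trans _ _ (huber_score tau x * (x - y))); first by lra.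
  rewrite (le_trans (ler_norm _)) // normrM.
  by rewrite ler_wpM2r ?huber_score_bound.
by rewrite ler_norml lerNl opprB key distrC key.
Qed.

Lemma huber_convex tau (tau_gt0 : 0 < tau) (u h s : R) : 0 <= s <= 1 ->
  huber tau (u + s * h) <= (1 - s) * huber tau u + s * huber tau (u + h).
Proof.
move=> /andP[s0 s1]; set x := u + s * h.
have /andP[H0 _] := huber_taylor tau_gt0 x (- (s * h)).
have /andP[H1 _] := huber_taylor tau_gt0 x ((1 - s) * h).
rewrite {1}/x addrK in H0.
have E : x + (1 - s) * h = u + h by rewrite /x; ring.
rewrite E in H1; nra.
Qed.

Lemma derive1_huber tau (tau_gt0 : 0 < tau) (u : R) :
  derive1 (huber tau) u = huber_score tau u.
Proof.
rewrite derive1E; apply: cvg_lim => //.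
apply/cvgrPdist_le => e e0; near=> h.
have h0 : h != 0 by near: h; exact: nbhs_dnbhs_neq.
rewrite /GRing.scale /= mulr1 [h + u]addrC.
have /andP[H0 H1] := huber_taylor tau_gt0 u h.
have -> : huber_score tau u - h^-1 * (huber tau (u + h) - huber tau u) =
  - (h^-1 * (huber tau (u + h) - huber tau u - huber_score tau u * h)).
  by field.
rewrite normrN normrM normrV ?unitfE // (ger0_norm H0) ler_pdivrMl ?normr_gt0 //.
apply: (le_trans H1).
have h2e : `|h| <= 2 * e.
  near: h; apply: dnbhs0_le; lra.
rewrite -(real_normK (num_real h)).
have := normr_ge0 h; nra.
Unshelve. all: by end_near.
Qed.

(** If |u| and |h| are at most tau / 2, then u and u - h both lie where the loss
    is u^2 / 2; otherwise huber_taylor bounds the defect of the quadratic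
    approximation by h^2 / 2. *)
Lemma huber_gap tau (tau_gt0 : 0 < tau) (u h : R)
    (D := huber tau u - huber tau (u - h) - huber_score tau u * h) :
  - (h ^+ 2 / 2) <= D /\
  D + h ^+ 2 / 2 <= if (tau / 2 < `|u|) || (tau / 2 < `|h|) then h ^+ 2 / 2 else 0.
Proof.
have := huber_taylor tau_gt0 u (- h); rewrite sqrrN mulrN => /andP[H0 H1].
rewrite /D; split; first by lra.
case: ifPn => [_|]; first by lra.
rewrite negb_or -!leNgt !ler_norml => /andP[/andP[u1 u2] /andP[h1 h2]].
case: (huberP tau_gt0 (u - h)) => [_|h3|h3];
  case: (huberP tau_gt0 u) => [_|u3|u3]; nra.
Qed.

End Huber.

(** * A finite lattice net of the Euclidean ball *)

Section Lattice.
Context {R : realType} {d : nat}.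
Implicit Types (p u z : 'cV[R]_d).

(** With this step, rounding a vector toward 0 moves it by at most 1/2. *)
Definition mesh : R := (2 * Num.sqrt d%:R)^-1.

Definition lattice p : Prop :=
  exists k : 'I_d -> int, forall i, p i 0 = mesh * (k i)%:~R.

Lemma latticeD p z : lattice p -> lattice z -> lattice (p + z).
Proof.
move=> [k Hk] [l Hl]; exists (fun i => k i + l i) => i.
by rewrite mxE Hk Hl intrD mulrDr.
Qed.

Lemma latticeN p : lattice p -> lattice (- p).
Proof.
by move=> [k Hk]; exists (fun i => - k i) => i; rewrite mxE Hk intrN mulrN.
Qed.

Lemma round_toward_zero (x : R) : exists k : int,
  `|x - k%:~R| <= 1 /\ `|k%:~R : R| <= `|x|.
Proof.
wlog x0 : x / 0 <= x.
  move=> H; have [/H//|/ltW x0] := lerP 0 x.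
  have [|k [k1 k2]] := H (- x); first by rewrite oppr_ge0.
  exists (- k); rewrite intrN normrN; split; last by rewrite -(normrN x).
  by rewrite opprK -normrN opprD.
exists (Num.floor x); have := floor_le x; have := floorD1_gt x.
rewrite intrD => H1 H2.
have H3 : 0 <= ((Num.floor x)%:~R : R) by rewrite ler0z floor_ge0.
split; first by rewrite ler_norml; apply/andP; split; lra.
by rewrite !ger0_norm.
Qed.


Hypothesis d_gt0 : (0 < d)%N.

Lemma mesh_gt0 : 0 < mesh.
Proof. by rewrite invr_gt0 mulr_gt0 // sqrtr_gt0 ltr0n. Qed.

Lemma mesh_sqr : mesh ^+ 2 * (4 * d%:R) = 1.
Proof.
rewrite /mesh exprVn exprMn sqr_sqrtr ?ler0n //.
have : (d%:R : R) != 0 by rewrite pnatr_eq0 -lt0n.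
by move=> ?; field.
Qed.

Lemma lattice_round u : l2norm u <= 1 ->
  exists z, [/\ lattice z, l2norm z <= 1 & l2norm (u - z) <= 2^-1].
Proof.
move=> u1; have h0 := mesh_gt0.
have /choice[k Hk] := fun i : 'I_d => round_toward_zero (u i 0 / mesh).
pose z : 'cV[R]_d := \col_i (mesh * (k i)%:~R).
have zE i : z i 0 = mesh * (k i)%:~R by rewrite mxE.
have zu i : `|z i 0| <= `|u i 0|.
  have [_] := Hk i; rewrite zE !normrM normrV ?unitfE ?gt_eqF //.
  by rewrite (gtr0_norm h0) ler_pdivlMr // mulrC.
have uz i : `|(u - z) i 0| <= mesh.
  have [H _] := Hk i; rewrite !mxE.
  have -> : u i 0 - mesh * (k i)%:~R = mesh * (u i 0 / mesh - (k i)%:~R).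
    by rewrite mulrBr mulrCA mulfV ?mulr1 // gt_eqF.
  by rewrite normrM (gtr0_norm h0) -[leRHS]mulr1 ler_pM2l.
exists z; split.
- by exists k.
- apply: le_trans u1; rewrite ler_wsqrtr // /dot ler_sum // => i _.
  by rewrite -!expr2 -(real_normK (num_real (z i 0)))
             -(real_normK (num_real (u i 0))) lerXn2r ?nnegrE.
rewrite -(ler_pXn2r (ltn0Sn 1)) ?nnegrE ?l2norm_ge0 ?invr_ge0 // sqr_l2norm.
apply: (@le_trans _ _ (\sum_(i < d) mesh ^+ 2)).
  rewrite ler_sum // => i _; rewrite -expr2 -(real_normK (num_real _)).
  by rewrite lerXn2r ?nnegrE ?(ltW h0).
rewrite sumr_const card_ord -[mesh ^+ 2 *+ d]mulr_natr.
have := mesh_sqr; lra.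
Qed.

(** Coordinates of lattice points of the ball of radius 2 are signed natural
    numbers whose sum is at most 16 d, because the sum of their squares is. *)
Lemma lattice_net : exists s : seq 'cV[R]_d,
  [/\ (size s <= 2 ^ (18 * d))%N, forall p, p \in s -> l2norm p <= 2 &
      forall p, lattice p -> l2norm p <= 2 -> p \in s].
Proof.
pose N := (16 * d)%N.
pose A0 := finset.finset
  (fun x : d.-tuple 'I_N.+1 => (\sum_(i <- x) i <= N)%N).
pose A := finset.setX [set: {ffun 'I_d -> bool}]%SET A0.
pose f (x : {ffun 'I_d -> bool} * d.-tuple 'I_N.+1) : 'cV[R]_d :=
  \col_i (mesh * ((-1) ^+ x.1 i * (tnth x.2 i)%:R)).
exists [seq p <- [seq f x | x in A] | l2norm p <= 2]; split.
- rewrite size_filter (leq_trans (count_size _ _)) // size_map -cardE.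
  rewrite cardsX cardsT card_ffun card_bool card_ord.
  rewrite card_partial_ord_partitions.
  have H : ('C(d + N, d) <= 2 ^ (d + N))%N.
    rewrite -[2%N]/(1 + 1)%N expnDn.
    rewrite (bigD1 (Ordinal (leq_addr N d.+1 : d < (d + N).+1)%N)) //=.
    by rewrite !exp1n !muln1 leq_addr.
  apply: leq_trans (leq_mul (leqnn _) H) _; rewrite -expnD leq_exp2l //.
- by move=> p; rewrite mem_filter => /andP[].
move=> p [k Hk] p2; rewrite mem_filter p2 /=.
have k16 : (\sum_(i < d) `|k i| <= N)%N.
  rewrite -(ler_nat R); apply: (@le_trans _ _ (\sum_(i < d) (k i)%:~R ^+ 2)).
    rewrite natr_sum ler_sum // => i _.
    by rewrite natr_absz -rmorphXn ler_int; nia.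
  have kE i : (k i)%:~R ^+ 2 = (4 * d%:R) * p i 0 ^+ 2 :> R.
    by rewrite Hk exprMn mulrA [_ * mesh ^+ 2]mulrC mesh_sqr mul1r.
  under eq_bigr do rewrite kE.
  rewrite -mulr_sumr natrM; under eq_bigr do rewrite expr2.
  rewrite -/(dot p p) -sqr_l2norm.
  have : l2norm p ^+ 2 <= 2 ^+ 2 by rewrite lerXn2r ?nnegrE ?l2norm_ge0.
  have : 0 <= (d%:R : R) by []; nra.
have kN i : (`|k i| < N.+1)%N.
  by rewrite ltnS; apply: leq_trans k16; rewrite (bigD1 i) //= leq_addr.
apply/mapP; exists ([ffun i => k i < 0], [tuple Ordinal (kN i) | i < d]).
  rewrite mem_enum !inE /= (leq_trans _ k16) //.
  by rewrite big_map big_enum.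
apply/matrixP => i j; rewrite ord1 !mxE Hk ffunE tnth_mktuple /=.
by congr (_ * _); rewrite {1}[k i]intEsign intrM rmorph_sign.
Qed.


(** Write u = (2 z + 2 (u - z)) / 2 with z a lattice point within 1/2 of u:
    the supremum over the ball is at most half itself plus half the maximum
    over the net. *)
Lemma midpoint_convex_net (Phi : 'cV[R]_d -> R) (M D : R) :
  (forall x y, Phi (2^-1 *: (x + y)) <= 2^-1 * (Phi x + Phi y)) ->
  (forall u, l2norm u <= 1 -> Phi u <= D) ->
  (forall z, lattice z -> l2norm z <= 1 -> Phi (2 *: z) <= M) ->
  forall u, l2norm u <= 1 -> Phi u <= M.
Proof.
move=> cvx bnd net.
pose E := [set Phi u | u in [set u | l2norm u <= 1]].
have E0 : E !=set0.
  exists (Phi 0); exists 0 => //=.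
  by rewrite /l2norm dot0l sqrtr0.
have supE : has_sup E by split=> //; exists D => _ [u u1 <-]; exact: bnd.
have leS u : l2norm u <= 1 -> Phi u <= sup E.
  by move=> u1; apply: sup_upper_bound => //; exists u.
suff H : sup E <= M by move=> u /leS/le_trans; apply.
suff H : sup E <= 2^-1 * (M + sup E) by lra.
apply: ge_sup => // _ [u u1 <-].
have [z [latz z1 uz]] := lattice_round u1.
have {1}-> : u = 2^-1 *: (2 *: z + 2 *: (u - z)).
  by rewrite -scalerDr scalerA mulVf // scale1r addrC subrK.
apply: le_trans (cvx _ _) _; rewrite ler_pM2l // lerD ?net ?leS //.
by rewrite l2normZ gtr0_norm //; lra.
Qed.

Lemma ball_normalize u : exists e, l2norm e <= 1 /\ u = l2norm u *: e.
Proof.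
have [->|u0] := eqVneq u 0.
  by exists 0; rewrite scaler0 /l2norm dot0l sqrtr0.
have nu : 0 < l2norm u by rewrite sqrtr_gt0 dot_gt0.
exists ((l2norm u)^-1 *: u); rewrite l2normZ scalerA mulfV ?gt_eqF // scale1r.
by rewrite gtr0_norm ?invr_gt0 // mulVf ?gt_eqF.
Qed.

Lemma le_l2norm_ball u (M : R) :
  (forall e, l2norm e <= 1 -> dot e u <= M) -> l2norm u <= M.
Proof.
move=> H; have [u0|u0] := eqVneq u 0.
  have := H 0; rewrite dot0l u0 /l2norm dot0l sqrtr0 => H0; apply: H0.
  exact: ler01.
have nu : 0 < l2norm u by rewrite sqrtr_gt0 dot_gt0.
have := H ((l2norm u)^-1 *: u); rewrite l2normZ dotZl -sqr_l2norm expr2 mulKf.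
  by apply; rewrite gtr0_norm ?invr_gt0 // mulVf ?gt_eqF.
by rewrite gt_eqF.
Qed.

Lemma lattice_scale2 z : lattice z -> l2norm z <= 1 ->
  lattice (2 *: z) /\ l2norm (2 *: z) <= 2.
Proof.
move=> lz z1; split; first by rewrite scaler_nat mulr2n; apply: latticeD.
by rewrite l2normZ gtr0_norm //; lra.
Qed.

Lemma l2normD u z : l2norm (u + z) <= l2norm u + l2norm z.
Proof.
rewrite -(ler_pXn2r (ltn0Sn 1)) ?nnegrE ?addr_ge0 ?l2norm_ge0 //.
rewrite sqr_l2norm sqrrD !sqr_l2norm dotDl !dotDr (dotC z u).
have := cauchy_schwarz u z; lra.
Qed.

Lemma l2normN u : l2norm (- u) = l2norm u.
Proof. by rewrite -scaleN1r l2normZ normrN1 mul1r. Qed.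

Lemma linear_net u (M : R) :
  (forall p, lattice p -> l2norm p <= 2 -> dot p u <= M) -> l2norm u <= M.
Proof.
move=> net; apply: le_l2norm_ball => e.
apply: (midpoint_convex_net (Phi := fun e => dot e u) (D := l2norm u)).
- by move=> x y; rewrite dotZl dotDl.
- move=> {}e e1; apply: le_trans (cauchy_schwarz _ _) _.
  by rewrite -[leRHS]mul1r ler_wpM2r ?l2norm_ge0.
by move=> z lz z1; have [] := lattice_scale2 lz z1; apply: net.
Qed.

(** Bilinearity lets both arguments be pushed to the net, and polarization
    brings the resulting off-diagonal values back to the diagonal. *)
Lemma quadratic_net (A : 'M[R]_d) (M : R) : A^T = A ->
  (forall p, lattice p -> l2norm p <= 2 -> `|dot p (A *m p)| <= M) ->
  forall u, l2norm u <= 1 -> dot u (A *m u) <= 2 * M.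
Proof.
move=> symA net.
have sym x y : dot x (A *m y) = dot y (A *m x).
  by rewrite dotC dot_mulmx symA.
have lin u v c : (forall z, lattice z -> l2norm z <= 1 -> dot (2 *: z) v <= c) ->
    l2norm u <= 1 -> dot u v <= c.
  move=> H; apply: (midpoint_convex_net (Phi := fun e => dot e v) (D := l2norm v)).
  - by move=> x y; rewrite dotZl dotDl.
  - move=> {}e e1; apply: le_trans (cauchy_schwarz _ _) _.
    by rewrite -[leRHS]mul1r ler_wpM2r ?l2norm_ge0.
  exact: H.
move=> u u1; apply: (lin u) => // z lz z1; rewrite sym.
apply: (lin u) => // y ly y1; rewrite -scalemxAr !dotZl !dotZr.
have /ler_normlP[_ H1] : `|dot (y + z) (A *m (y + z))| <= M.
  apply: net; first exact: latticeD.
  by apply: le_trans (l2normD _ _) _; lra.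
have /ler_normlP[H2 _] : `|dot (y - z) (A *m (y - z))| <= M.
  apply: net; first by apply/latticeD/latticeN.
  by apply: le_trans (l2normD _ _) _; rewrite l2normN; lra.
move: H1 H2; rewrite mulmxBr mulmxDr dotBl !dotBr dotDl !dotDr (sym z y).
lra.
Qed.

Lemma quadratic_net_abs (A : 'M[R]_d) (M : R) : A^T = A ->
  (forall p, lattice p -> l2norm p <= 2 -> `|dot p (A *m p)| <= M) ->
  forall u, `|dot u (A *m u)| <= 2 * M * l2norm u ^+ 2.
Proof.
move=> symA net u; have [e [e1 ue]] := ball_normalize u.
rewrite {1 2}ue -scalemxAr dotZl dotZr mulrA -expr2 normrM mulrC.
rewrite (ger0_norm (sqr_ge0 _)) ler_wpM2r ?sqr_ge0 //.
rewrite ler_norml lerNl quadratic_net //= andbT.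
rewrite -dotNl dotC dot_mulmx -[- e]scaleN1r -scalemxAr.
have symNA : (- A)^T = - A by rewrite linearN /= symA.
have := quadratic_net symNA (M := M); rewrite symA scaleN1r -mulNmx; apply => //.
by move=> p lp p2; rewrite mulNmx dotC dotNl normrN dotC net.
Qed.

End Lattice.

(** * Integrals against functions of a random element *)

Section Transfer.
Local Open Scope ereal_scope.
Context {dT dS : measure_display} {T : measurableType dT}
  {S : measurableType dS} {R : realType} (mu : {measure set T -> \bar R}).
Implicit Types (V : T -> S) (W : T -> R) (h : S -> R).

Import HBNNSimple.

Lemma integral_nnsfun_comp V W (g : {nnsfun S >-> R}) :
  measurable_fun setT V -> measurable_fun setT W -> (forall x, 0 <= W x)%R ->
  \int[mu]_x (W x * g (V x))%:E =
  \sum_(r \in range g) r%:E * \int[mu]_x (W x * \1_(g @^-1` [set r]) (V x))%:E.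
Proof.
move=> mV mW W0.
have mI (r : R) : measurable_fun [set: T]
    (fun x : T => (W x * \1_(g @^-1` [set r]) (V x))%:E).
  apply/measurable_EFinP/measurable_funM => //.
  apply: (@measurableT_comp _ _ _ _ _ _ (\1_(g @^-1` [set r]) : S -> R)) => //.
transitivity (\int[mu]_x \sum_(r \in range g)
    (r%:E * (W x * \1_(g @^-1` [set r]) (V x))%:E)).
  apply: eq_integral => x _; rewrite fimfunE mulr_fsumr -fsumEFin //.
  by apply: eq_fsbigr => r _; rewrite -EFinM mulrCA.
rewrite ge0_integral_fsum //.
- apply: eq_fsbigr => r; rewrite inE => -[s _ <-].
  by rewrite ge0_integralZl_EFin // => x _; rewrite lee_fin mulr_ge0.
- by move=> r; exact: emeasurable_funM.
move=> r x _; rewrite -EFinM mulrCA EFinM mule_ge0 ?lee_fin //.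
exact: nnfun_muleindic_ge0.
Qed.

(** Both sides are continuous along the simple functions increasing to h, so
    indicators are enough.  Used for identically distributed V1 and V2, for
    independence (W1 a function of the other variables, W2 constant) and for
    conditional expectations (V1 = V2 the conditioning variable). *)
Lemma le_integral_weight V1 V2 W1 W2 h :
  measurable_fun setT V1 -> measurable_fun setT V2 ->
  measurable_fun setT W1 -> measurable_fun setT W2 ->
  (forall x, 0 <= W1 x)%R -> (forall x, 0 <= W2 x)%R ->
  measurable_fun setT h -> (forall s, 0 <= h s)%R ->
  (forall B, measurable B ->
    \int[mu]_x (W1 x * \1_B (V1 x))%:E <= \int[mu]_x (W2 x * \1_B (V2 x))%:E) ->
  \int[mu]_x (W1 x * h (V1 x))%:E <= \int[mu]_x (W2 x * h (V2 x))%:E.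
Proof.
move=> mV1 mV2 mW1 mW2 W10 W20 mh h0 le12.
have mhE : measurable_fun setT (EFin \o h) by exact/measurable_EFinP.
pose g := nnsfun_approx measurableT mhE.
have lim V W : measurable_fun setT V -> measurable_fun setT W ->
    (forall x, 0 <= W x)%R ->
    \int[mu]_x (W x * g n (V x))%:E @[n --> \oo] -->
    \int[mu]_x (W x * h (V x))%:E.
  move=> mV mW W0.
  have -> : \int[mu]_x (W x * h (V x))%:E =
      \int[mu]_x limn (fun n => (W x * g n (V x))%:E).
    apply: eq_integral => x _; apply/esym/cvg_lim => //=.
    under eq_fun do rewrite EFinM; rewrite EFinM.
    apply: cvgeZl => //; apply: (@cvg_nnsfun_approx _ _ _ _ measurableT _ mhE) => //.
    by move=> s _; rewrite lee_fin.
  apply: cvg_monotone_convergence => //.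
  - move=> n; apply/measurable_EFinP/measurable_funM => //.
    exact: (measurableT_comp (@measurable_funPT _ _ _ _ (g n))).
  - by move=> n x _; rewrite lee_fin mulr_ge0.
  - move=> x _ a b ab; rewrite lee_fin ler_wpM2l //.
    exact/lefP/nd_nnsfun_approx.
apply: (lee_cvg_to (lim V1 W1 mV1 mW1 W10) (lim V2 W2 mV2 mW2 W20)).
apply: nearW => n; rewrite !integral_nnsfun_comp //.
apply: lee_fsum => // r [s _ <-].
rewrite lee_wpmul2l ?lee_fin // le12 //.
Qed.
End Transfer.

Section Independence.
Local Open Scope ereal_scope.
Context {dT dS : measure_display} {T : measurableType dT}
  {S : measurableType dS} {R : realType} (P : probability T R).

Lemma integral_indic_comp (V : T -> S) (B : set S) :
  measurable_fun setT V -> measurable B ->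
  \int[P]_x (\1_B (V x))%:E = P (V @^-1` B).
Proof.
move=> mV mB; have mVB : measurable (V @^-1` B) by rewrite -[_ @^-1` _]setTI; exact: mV.
rewrite -[V @^-1` B]setIT -integral_indic //; exact: eq_integral.
Qed.

(** Independence is given on events.  The indicators are replaced by h one index
    at a time: the first m factors have already been replaced. *)
Lemma iid_integral_prod_mixed n (V : 'I_n -> T -> S) (W : T -> S) (h : S -> R)
    (a : R) :
  (forall i, measurable_fun setT (V i)) -> measurable_fun setT W ->
  iid_copies P V W -> measurable_fun setT h -> (forall s, 0 <= h s)%R ->
  \int[P]_x (h (W x))%:E <= a%:E ->
  forall m (B : 'I_n -> set S), (m <= n)%N -> (forall i, measurable (B i)) ->
  \int[P]_x (\prod_(i < n) (if (i < m)%N then h (V i x) else \1_(B i) (V i x)))%:E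
  <= (\prod_(i < n) (if (i < m)%N then a else fine (P (W @^-1` B i))))%:E.
Proof.
move=> mV mW [indep ident] mh h0 ha.
have a0 : (0 <= a)%R.
  by rewrite -lee_fin; apply: le_trans ha; apply: integral_ge0 => x _; rewrite lee_fin.
have mWB B : measurable B -> measurable (W @^-1` B).
  by move=> mB; rewrite -[_ @^-1` _]setTI; exact: mW.
elim=> [|m IH] B mn mB.
  have -> : \int[P]_x (\prod_(i < n) (if (i < 0)%N then h (V i x)
      else \1_(B i) (V i x)))%:E = \int[P]_x
      (\1_(\bigcap_(i in [set` [set: 'I_n]%SET]) (V i @^-1` B i)) x)%:E.
    apply: eq_integral => x _; congr (_%:E); rewrite indicE.
    have [xin|xin] := boolP (x \in _).
      rewrite big1 // => i _.
      rewrite indicE mem_set //.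
      by move: xin; rewrite inE => /(_ i); apply; rewrite /= inE.
    apply/eqP; apply: contraNT xin => /prodf_neq0 xin; rewrite inE => i _ /=.
    by have := xin i isT; rewrite ?ltn0 indicE pnatr_eq0 eqb0 negbK inE.
  rewrite integral_indic ?setIT; last 2 first.
  - exact: measurableT.
  - apply: fin_bigcap_measurable; first exact: finite_finset.
    by move=> i _; rewrite -[_ @^-1` _]setTI; exact: mV.
  rewrite [leLHS](indep [set: 'I_n]%SET B mB) -prodEFin le_eqVlt; apply/orP; left.
  apply/eqP => /=; under eq_bigl do rewrite inE.
  by apply: eq_bigr => i _; rewrite ident // fineK // fin_num_measure //; exact: mWB.
pose j := Ordinal mn.
have jm (i : 'I_n) : i != j -> (i < m.+1)%N = (i < m)%N.
  by move=> ij; rewrite ltnS leq_eqVlt -[_ == m]/(i == j) (negbTE ij).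
pose F (x : T) (i : 'I_n) := if (i < m)%N then h (V i x) else \1_(B i) (V i x).
pose c := (\prod_(i < n | i != j) (if (i < m)%N then a else fine (P (W @^-1` B i))))%R.
have c0 : (0 <= c)%R.
  by apply: prodr_ge0 => i _; case: ifP => // _; rewrite fine_ge0.
have -> : \int[P]_x (\prod_(i < n) (if (i < m.+1)%N then h (V i x)
    else \1_(B i) (V i x)))%:E =
    \int[P]_x ((\prod_(i < n | i != j) F x i) * h (V j x))%:E.
  apply: eq_integral => x _; rewrite (bigD1 j) //= ltnSn mulrC.
  by congr (_ * _)%:E; apply: eq_bigr => i ij; rewrite jm.
have -> : (\prod_(i < n) (if (i < m.+1)%N then a else fine (P (W @^-1` B i))) =
    c * a)%R.
  rewrite (bigD1 j) //= ltnSn mulrC.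
  by congr (_ * _)%R; apply: eq_bigr => i ij; rewrite jm.
have mF i : measurable_fun setT (fun x => F x i).
  rewrite /F; case: (i < m)%N; first exact: measurableT_comp.
  apply: (@measurableT_comp _ _ _ _ _ _ (\1_(B i) : S -> R)) => //.
apply: (@le_trans _ _ (\int[P]_x (c * h (W x))%:E)).
  apply: (@le_integral_weight _ _ _ _ _ P (V j) W
    (fun x => \prod_(i < n | i != j) F x i)%R (fun=> c) h) => //.
  - have -> : (fun x => \prod_(i < n | i != j) F x i)%R =
        (fun x => \prod_(i <- enum [pred i | i != j]) F x i)%R.
      by apply/funext => x; rewrite big_enum.
    by apply: measurable_prod => i _; exact: mF.
  - by move=> x; apply: prodr_ge0 => i _; rewrite /F; case: ifP.
  move=> C mC; pose B' i := if i == j then C else B i.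
  have := IH B' (ltnW mn).
  rewrite (bigD1 j) //= ltnn /B' eqxx.
  have -> : \int[P]_x (\prod_(i < n) (if (i < m)%N then h (V i x)
     else \1_(if i == j then C else B i) (V i x)))%:E =
     \int[P]_x (\prod_(i < n | i != j) F x i * \1_C (V j x))%:E.
    apply: eq_integral => x _; rewrite (bigD1 j) //= ltnn eqxx mulrC.
    by congr (_ * _)%:E; apply: eq_bigr => i ij; rewrite (negbTE ij).
  move=> H; apply: (le_trans (H _)) => {H}.
    by move=> i; case: ifP.
  under eq_integral do rewrite EFinM.
  rewrite ge0_integralZl_EFin //; last first.
    apply/measurable_EFinP.
    apply: (@measurableT_comp _ _ _ _ _ _ (\1_C : S -> R)) => //.
  rewrite integral_indic_comp // mulrC EFinM fineK; last first.
    by rewrite fin_num_measure //; exact: mWB.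
  by under eq_bigr => i ij do rewrite (negbTE ij).
under eq_integral do rewrite EFinM.
rewrite ge0_integralZl_EFin //.
- by rewrite EFinM lee_wpmul2l // lee_fin.
- by move=> x _; rewrite lee_fin.
- by apply/measurable_EFinP; exact: measurableT_comp.
Qed.

Lemma iid_integral_prod n (V : 'I_n -> T -> S) (W : T -> S) (h : S -> R) (a : R) :
  (forall i, measurable_fun setT (V i)) -> measurable_fun setT W ->
  iid_copies P V W -> measurable_fun setT h -> (forall s, 0 <= h s)%R ->
  \int[P]_x (h (W x))%:E <= a%:E ->
  \int[P]_x (\prod_(i < n) h (V i x))%:E <= (a ^+ n)%:E.
Proof.
move=> mV mW iid mh h0 ha.
have := iid_integral_prod_mixed mV mW iid mh h0 ha (leqnn n) (fun=> measurableT).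
rewrite (eq_bigr (fun=> a)) ?prodr_const ?card_ord; last by move=> i; rewrite ltn_ord.
apply: le_trans; rewrite le_eqVlt; apply/orP; left; apply/eqP.
by apply: eq_integral => x _; congr (_%:E); apply: eq_bigr => i _; rewrite ltn_ord.
Qed.

Lemma iid_chernoff n (V : 'I_n -> T -> S) (W : T -> S) (f : S -> R) (c b : R) :
  (forall i, measurable_fun setT (V i)) -> measurable_fun setT W ->
  iid_copies P V W -> measurable_fun setT f ->
  \int[P]_x (expR (f (W x)))%:E <= (expR c)%:E ->
  P [set x | (b <= \sum_(i < n) f (V i x))%R] <= (expR (n%:R * c - b))%:E.
Proof.
move=> mV mW iid mf hc.
have mef : measurable_fun setT (fun s => expR (f s)) by exact: measurableT_comp.
have mg : measurable_fun setT (fun x => \prod_(i < n) expR (f (V i x)))%R.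
  by apply: measurable_prod => i _; exact: (measurableT_comp mef).
set A := [set x | _].
have mA : measurable A.
  rewrite -[A]setTI; apply: (measurable_fun_le measurableT (measurable_cst b)).
  by apply: measurable_sum => i; exact: measurableT_comp.
have g0 x : (0 <= \prod_(i < n) expR (f (V i x)))%R.
  by apply: prodr_ge0 => i _; exact: expR_ge0.
have := iid_integral_prod mV mW iid mef (fun s => expR_ge0 (f s)) hc.
rewrite -expRM_natl => H.
rewrite expRD mulrC EFinM.
apply: (le_trans _ (lee_wpmul2l _ H)); last by rewrite lee_fin expR_ge0.
rewrite -ge0_integralZl_EFin ?expR_ge0 //; last 2 first.
- by move=> x _; rewrite lee_fin.
- exact/measurable_EFinP.
rewrite -[A]setIT -integral_indic //; apply: ge0_le_integral => //.
- by apply/measurable_EFinP; exact: measurable_indic.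
- by apply: emeasurable_funM => //; exact/measurable_EFinP.
move=> y _; rewrite -EFinM lee_fin -expR_sum -expRD indicE.
have [|_] := boolP (y \in A); last exact: expR_ge0.
by rewrite inE /= => bx; rewrite -expR0 ler_expR addrC subr_ge0.
Qed.

Lemma iid_chernoff_union (I : eqType) (s : seq I) n (V : 'I_n -> T -> S)
    (W : T -> S) (f : I -> S -> R) (c b : R) :
  (forall i, measurable_fun setT (V i)) -> measurable_fun setT W ->
  iid_copies P V W ->
  (forall p, p \in s -> measurable_fun setT (f p)) ->
  (forall p, p \in s -> \int[P]_x (expR (f p (W x)))%:E <= (expR c)%:E) ->
  let bad := [set x | exists2 p, p \in s & (b <= \sum_(i < n) f p (V i x))%R] in
  measurable bad /\ P bad <= ((size s)%:R * expR (n%:R * c - b))%:E.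
Proof.
move=> mV mW iid; elim: s => [|p s IH] mf hc /=.
  have -> : [set x | exists2 p, p \in [::] & (b <= \sum_(i < n) f p (V i x))%R] = set0.
    by apply/seteqP; split => x // -[].
  by rewrite measure0 mul0r; split.
have [|q qs|mB leB] := IH; [by move=> q qs; apply: mf; rewrite inE qs orbT
  |by apply: hc; rewrite inE qs orbT|].
set A := [set x | (b <= \sum_(i < n) f p (V i x))%R].
have mA : measurable A.
  rewrite -[A]setTI; apply: (measurable_fun_le measurableT (measurable_cst b)).
  apply: measurable_sum => i.
  by apply: measurableT_comp; [apply: mf; rewrite mem_head|].
have -> : [set x | exists2 q, q \in p :: s & (b <= \sum_(i < n) f q (V i x))%R] =
    A `|` [set x | exists2 p, p \in s & (b <= \sum_(i < n) f p (V i x))%R].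
  apply/seteqP; split => x /=.
    move=> [q]; rewrite inE => /predU1P[->|qs] Hq; [by left|by right; exists q].
  case=> [?|[q qs Hq]]; first by exists p; rewrite ?mem_head.
  by exists q; rewrite ?inE ?qs ?orbT.
split; first exact: measurableU.
apply: (le_trans (measureU2 _ _ _)) => //.
rewrite -natr1 mulrDl mul1r addrC EFinD leeD //.
exact: (iid_chernoff b mV mW iid (mf p (mem_head _ _)) (hc p (mem_head _ _))).
Qed.

End Independence.

(** * Scalar inequalities *)

Section Scalar.
Context {R : realType}.
Implicit Types (x s tau delta : R).

Lemma expR_le_taylor x : expR x <= 1 + x + x ^+ 2 * expR `|x|.
Proof.
have H1 : expR x - 1 <= x * expR x.
  have := expR_ge1Dx (- x); rewrite -(ler_pM2r (expR_gt0 x)) expRN.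
  rewrite mulVf ?gt_eqF ?expR_gt0 //.
  lra.
have H2 := expR_ge1Dx x; have e0 := expR_gt0 x.
have [x0|x0] := lerP 0 x.
  by rewrite (ger0_norm x0) expr2 -mulrA; nra.
rewrite (ltr0_norm x0).
have : 1 <= expR (- x) by rewrite -expR0 ler_expR; lra.
have := sqr_ge0 x; rewrite expr2; nra.
Qed.

Lemma sqr_le_expR s x : 0 < s -> x ^+ 2 <= s^-1 * expR (s * x ^+ 2).
Proof.
move=> s0; rewrite ler_pdivlMl //; have := expR_ge1Dx (s * x ^+ 2); lra.
Qed.

Lemma norm_le_expR s x : 0 < s -> `|x| <= (1 + s^-1) * expR (s * x ^+ 2).
Proof.
move=> s0; have H := sqr_le_expR x s0.
have : 1 <= expR (s * x ^+ 2).
  by rewrite -expR0 ler_expR mulr_ge0 ?sqr_ge0 ?ltW.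
have := real_normK (num_real x); have := normr_ge0 x; nra.
Qed.

(** By the AM-GM inequality |x| <= (s / 2) x^2 + 1 / (2 s). *)
Lemma sqr_expR_norm_le s x : 0 < s ->
  x ^+ 2 * expR `|x| <= 2 * s^-1 * expR (2 * s)^-1 * expR (s * x ^+ 2).
Proof.
move=> s0; have s20 : 0 < s / 2 by lra.
have H := sqr_le_expR x s20.
have -> : s * x ^+ 2 = s / 2 * x ^+ 2 + s / 2 * x ^+ 2 by lra.
rewrite expRD [(s / 2)^-1]invf_div in H *.
have E : expR `|x| <= expR (2 * s)^-1 * expR (s / 2 * x ^+ 2).
  rewrite -expRD ler_expR -(real_normK (num_real x)).
  have -> : (2 * s)^-1 + s / 2 * `|x| ^+ 2 = `|x| + (s * `|x| - 1) ^+ 2 / (2 * s).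
    by field; lra.
  by rewrite lerDl divr_ge0 ?sqr_ge0 //; lra.
apply: le_trans (ler_pM _ _ H E) _; rewrite ?sqr_ge0 ?expR_ge0 //.
by rewrite le_eqVlt; apply/orP; left; apply/eqP; ring.
Qed.

Lemma sqr_le_expR_lin x : 0 <= x -> x ^+ 2 <= 4 * expR x.
Proof.
move=> x0; have -> : expR x = expR (x / 2) ^+ 2.
  by rewrite -expRM_natl; congr expR; lra.
have := expR_ge1Dx (x / 2); nra.
Qed.

Lemma powR_tail_le tau delta x : 0 < tau -> 0 <= delta -> tau <= x ->
  x <= x `^ (2 + delta) * tau `^ (- (1 + delta)).
Proof.
move=> t0 d0 tx; have x0 : 0 < x by lra.
have -> : 2 + delta = 1 + (1 + delta) by lra.
rewrite powRD; last by rewrite (gt_eqF x0) implybT.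
rewrite (powRr1 (ltW x0)) -mulrA (ler_pMr _ x0) powRN ler_pdivlMr ?powR_gt0 // mul1r.
by rewrite ge0_ler_powR ?nnegrE //; lra.
Qed.

(** This bounds the bias of the truncated residual by a moment of order 2 + delta. *)
Lemma huber_score_err tau delta x : 0 < tau -> 0 <= delta ->
  `|x - huber_score tau x| <= `|x| `^ (2 + delta) * tau `^ (- (1 + delta)).
Proof.
move=> t0 d0; case: (huberP t0 x) => [_|x1|x1].
- by rewrite subrr normr0 mulr_ge0 ?powR_ge0.
- have x0 : 0 < x by lra.
  rewrite (gtr0_norm x0) ger0_norm; last by lra.
  apply: le_trans (powR_tail_le t0 d0 x1); lra.
- have x0 : 0 < - x by lra.
  rewrite -(normrN x) (gtr0_norm x0) ler0_norm; last by lra.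
  apply: le_trans (powR_tail_le t0 d0 (_ : tau <= - x)); lra.
Qed.

Lemma tail_indicator_le tau delta x : 0 < tau -> 0 <= delta ->
  (tau < `|x|)%R%:R <= `|x| `^ (2 + delta) * tau `^ (- (2 + delta)).
Proof.
move=> t0 d0; have [tx|_] := ltrP tau `|x|; last by rewrite mulr_ge0 ?powR_ge0.
rewrite powRN ler_pdivlMr ?powR_gt0 // mul1r ge0_ler_powR ?nnegrE //; lra.
Qed.

End Scalar.

(** * Subgaussian and conditional moments *)

Section ExponentialMoments.
Local Open Scope ereal_scope.
Context {dT : measure_display} {T : measurableType dT} {R : realType}
  (P : probability T R).

(** The sum over k of exp ((k + 1) / 2) 2 exp (- k). *)
Definition gauss_moment : R := (2 * expR 2^-1 / (1 - expR (- 2^-1)))%R.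

(** Slicing along the integer part of U ^ 2 turns the tail bound into a
    geometric series. *)
Lemma subgaussian_exp_sqr (U : T -> R) :
  measurable_fun setT U ->
  (forall t : R, (0 <= t)%R ->
    P [set w | (t <= `|U w|)%R] <= (2 * expR (- t ^+ 2))%:E) ->
  \int[P]_w (expR (2^-1 * U w ^+ 2))%:E <= gauss_moment%:E.
Proof.
move=> mU tail.
pose A (k : nat) := [set w | (Num.sqrt k%:R <= `|U w|)%R].
have mA k : measurable (A k).
  rewrite -[A k]setTI; apply: (measurable_fun_le measurableT (measurable_cst _)).
  exact: measurableT_comp.
pose g (k : nat) (w : T) : \bar R := (expR ((k%:R + 1) / 2) * \1_(A k) w)%:E.
have mg k : measurable_fun setT (g k).
  by apply/measurable_EFinP/measurable_funM => //; exact: measurable_indic.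
have g0 k w : 0 <= g k w by rewrite lee_fin mulr_ge0 ?expR_ge0.
apply: (@le_trans _ _ (\int[P]_w \sum_(0 <= k <oo) g k w)).
  apply: ge0_le_integral => //.
  - apply/measurable_EFinP; apply: measurableT_comp => //.
    by apply: measurable_funM => //; exact: measurable_funX.
  - by apply: ge0_emeasurable_sum => // k w _ _; exact: g0.
  move=> w _; pose k := Num.truncn (U w ^+ 2).
  have /andP[k1 k2] : (k%:R <= U w ^+ 2 < k.+1%:R)%R by rewrite truncn_itv ?sqr_ge0.
  apply: (@le_trans _ _ (g k w)).
    rewrite /g indicE mem_set; last first.
      rewrite /A /= -(sqrtr_sqr (U w)) ler_wsqrtr //.
    rewrite mulr1 lee_fin ler_expR; move: k2; rewrite -natr1; lra.
  apply: le_trans (nneseries_lim_ge k.+1 _) => //.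
  rewrite big_nat_recr //= leeDr // sume_ge0 // => i _; exact: g0.
rewrite integral_nneseries //.
pose z : R := expR (- 2^-1).
have z0 : (0 < z)%R by exact: expR_gt0.
have z1 : (z < 1)%R by rewrite expR_lt1; lra.
apply: (@le_trans _ _ (\sum_(0 <= k <oo) (2 * expR 2^-1 * z ^+ k)%:E)).
  apply: lee_nneseries => [k _ _|k _].
    by apply: integral_ge0 => w _; exact: g0.
  under eq_integral do rewrite /g EFinM.
  rewrite ge0_integralZl_EFin ?expR_ge0 //; last first.
    by apply/measurable_EFinP; exact: measurable_indic.
  rewrite integral_indic // setIT.
  apply: (@le_trans _ _ ((expR ((k%:R + 1) / 2))%:E * (2 * expR (- k%:R))%:E)).
    rewrite lee_wpmul2l ?lee_fin ?expR_ge0 //.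
    by have := tail _ (sqrtr_ge0 k%:R); rewrite sqr_sqrtr.
  rewrite -EFinM lee_fin /z -expRM_natl mulrCA -expRD -mulrA -expRD.
  by rewrite ler_pM2l // ler_expR; lra.
apply: lime_le.
  apply: is_cvg_nneseries => k _ _.
  by rewrite lee_fin !mulr_ge0 ?exprn_ge0 ?expR_ge0 ?(ltW z0).
apply: nearW => n; rewrite sumEFin lee_fin -mulr_sumr /gauss_moment -/z.
rewrite ler_pM2l ?mulr_gt0 ?expR_gt0 // -[leRHS]mul1r ler_pdivlMr; last by lra.
rewrite big_mkord mulrC -[(1 - z)%R]opprB mulNr -subrX1 opprB.
by have := exprn_ge0 n (ltW z0); lra.
Qed.

End ExponentialMoments.

Lemma gauss_moment_ge1 (R : realType) : 1 <= @gauss_moment R.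
Proof.
have e1 := expR_ge1Dx (2^-1 : R); have e2 := expR_gt0 (- 2^-1 : R).
have e3 : expR (- 2^-1 : R) < 1 by rewrite expR_lt1; lra.
by rewrite /gauss_moment ler_pdivlMr; lra.
Qed.

Section ConditionalMoments.
Local Open Scope ereal_scope.
Context {dT dS : measure_display} {T : measurableType dT}
  {S : measurableType dS} {R : realType} (P : probability T R).
Implicit Types (X : T -> S) (f g : T -> R) (h : S -> R).

(** The linear term f0 of the expansion is centered, so only r contributes. *)
Lemma exp_moment_le (g f0 r : T -> R) (c : R) :
  measurable_fun setT g -> P.-integrable setT (EFin \o f0) ->
  \int[P]_w (f0 w)%:E = 0 -> measurable_fun setT r -> (forall w, 0 <= r w)%R ->
  \int[P]_w (r w)%:E <= c%:E ->
  (forall w, expR (g w) <= 1 + f0 w + r w)%R ->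
  \int[P]_w (expR (g w))%:E <= (expR c)%:E.
Proof.
move=> mg if0 f00 mr r0 rc gle.
have mf0 : measurable_fun setT f0 by apply/measurable_EFinP; exact: measurable_int if0.
have ir : P.-integrable setT (EFin \o r).
  apply/integrableP; split; first exact/measurable_EFinP.
  apply: le_lt_trans (ltry c); apply: le_trans rc.
  by under eq_integral do rewrite gee0_abs ?lee_fin //.
apply: (@le_trans _ _ (\int[P]_w ((EFin \o f0) w + (1%:E + (r w)%:E)))).
  apply: ge0_le_integral => //.
  - by apply/measurable_EFinP; exact: measurableT_comp.
  - apply: emeasurable_funD; first exact/measurable_EFinP.
    by apply: emeasurable_funD => //; exact/measurable_EFinP.
  - move=> w _ /=; rewrite -!EFinD lee_fin; have := gle w; lra.
have i1 : P.-integrable [set: T] (fun=> 1%:E : \bar R).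
  exact: (finite_measure_integrable_cst P 1 measurableT).
rewrite (integralD measurableT if0 (integrableD measurableT i1 ir)).
rewrite f00 add0e (integralD measurableT i1 ir).
have -> : \int[P]_x (1%:E : \bar R) = 1%:E.
  by rewrite integral_cst // mul1e; exact: probability_setT.
apply: (@le_trans _ _ (1%:E + c%:E)); first by rewrite leeD2l.
by rewrite -EFinD lee_fin expR_ge1Dx.
Qed.

Lemma integral_preimage X f (B : set S) :
  \int[P]_w (f w * \1_B (X w))%:E = \int[P]_(w in X @^-1` B) (f w)%:E.
Proof.
rewrite [RHS]integral_mkcond epatch_indic; apply: eq_integral => w _ /=.
by rewrite EFinM.
Qed.

Lemma cond_expectation_integral X f g (B : set S) :
  is_cond_expectation P X f g -> measurable B ->
  \int[P]_w (f w * \1_B (X w))%:E = \int[P]_w (g w * \1_B (X w))%:E.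
Proof.
move=> [_ _ _ fg] mB; rewrite !integral_preimage; apply: fg.
by exists B => //; rewrite setTI.
Qed.

Lemma measurable_cond_expectation X f g :
  is_cond_expectation P X f g -> measurable_fun setT f.
Proof. by move=> [H _ _ _]; apply/measurable_EFinP; exact: measurable_int H. Qed.

Lemma cond_expectation_le X f g h (a : R) :
  is_cond_expectation P X f g -> measurable_fun setT X ->
  (forall w, 0 <= f w)%R -> (0 <= a)%R -> {ae P, forall w, (g w <= a)%R} ->
  measurable_fun setT h -> (forall s, 0 <= h s)%R ->
  \int[P]_w (f w * h (X w))%:E <= a%:E * \int[P]_w (h (X w))%:E.
Proof.
move=> fg mX f0 a0 ga mh h0; have mf := measurable_cond_expectation fg.
rewrite -ge0_integralZl_EFin //; last 2 first.
- by move=> w _; rewrite lee_fin.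
- by apply/measurable_EFinP; exact: measurableT_comp.
under [leRHS]eq_integral do rewrite -EFinM.
apply: (@le_integral_weight _ _ _ _ _ P X X f (fun=> a) h) => // B mB.
rewrite (cond_expectation_integral fg mB).
have [_ ig _ _] := fg.
have mg : measurable_fun setT g by apply/measurable_EFinP; exact: measurable_int ig.
have mXB : measurable (X @^-1` B) by rewrite -[_ @^-1` _]setTI; exact: mX.
rewrite !integral_preimage.
(* g is at most a only almost everywhere; min (g, a) is so everywhere *)
pose g' w := Num.min (g w) a.
have -> : \int[P]_(w in X @^-1` B) (g w)%:E = \int[P]_(w in X @^-1` B) (g' w)%:E.
  apply: ae_eq_integral => //.
  - by apply: measurable_funTS; exact/measurable_EFinP.
  - by apply: measurable_funTS; apply/measurable_EFinP; exact: measurable_minr.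
  apply: filterS ga => w gwa _; rewrite /g'.
  by congr (_%:E); apply/esym/min_idPl.
have ia : P.-integrable [set: T] (EFin \o cst a).
  exact: finite_measure_integrable_cst.
apply: le_integral => //.
- apply: (integrableS measurableT) => //.
  apply: (le_integrable measurableT (g := (fun w => `|(g w)%:E| + `|a%:E|))).
  + by apply/measurable_EFinP; exact: measurable_minr.
  + move=> w _; rewrite /g' /= lee_fin.
    rewrite (ger0_norm (_ : 0 <= `|g w| + `|a|)%R) ?addr_ge0 //.
    by rewrite minEle; case: ifP => _; rewrite ?lerDl ?lerDr.
  by apply: integrableD => //; apply: integrable_abse.
- by apply: (integrableS measurableT).
by move=> w _; rewrite lee_fin ge_min lexx orbT.
Qed.

(** The positive and the negative part of f integrate alike against nonnegative
    functions of X; h is split into its positive and negative parts too. *)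
Lemma cond_centered X f h :
  is_cond_expectation P X f (cst 0%R) -> measurable_fun setT X ->
  measurable_fun setT h ->
  P.-integrable setT (fun w => (f w * h (X w))%:E) ->
  \int[P]_w (f w * h (X w))%:E = 0.
Proof.
move=> f0 mX mh ifh; have mf := measurable_cond_expectation f0.
have [if_ _ _ _] := f0.
pose p (x : R) := Num.max x 0%R; pose m (x : R) := Num.max (- x)%R 0%R.
have mp (k : T -> R) : measurable_fun setT k -> measurable_fun setT (p \o k).
  by move=> mk; exact: measurable_maxr.
have mm (k : T -> R) : measurable_fun setT k -> measurable_fun setT (m \o k).
  by move=> mk; apply: measurable_maxr => //; exact: measurableT_comp.
have p0 x : (0 <= p x)%R by rewrite /p le_max lexx orbT.
have m0 x : (0 <= m x)%R by rewrite /m le_max lexx orbT.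
have Ep (k : T -> R) : (fun w => (k w)%:E)^\+ = (fun w => (p (k w))%:E).
  by apply/funext => w; rewrite funeposE -EFin_max.
have Em (k : T -> R) : (fun w => (k w)%:E)^\- = (fun w => (m (k w))%:E).
  by apply/funext => w; rewrite funenegE -EFinN -EFin_max.
have eqB B : measurable B -> \int[P]_w (p (f w) * \1_B (X w))%:E =
    \int[P]_w (m (f w) * \1_B (X w))%:E.
  move=> mB; have := cond_expectation_integral f0 mB.
  under [X in _ = X -> _]eq_integral do rewrite mul0r.
  rewrite integral0 !integral_preimage integralE.
  have mXB : measurable (X @^-1` B) by rewrite -[_ @^-1` _]setTI; exact: mX.
  have ifB : P.-integrable (X @^-1` B) (EFin \o f) by exact: (integrableS measurableT).
  have fp := integrable_pos_fin_num mXB ifB.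
  have fm := integrable_neg_fin_num mXB ifB.
  by move=> /eqP; rewrite sube_eq ?add0e // => /eqP; rewrite Ep Em.
have eqk (l : S -> R) : measurable_fun setT l -> (forall s, 0 <= l s)%R ->
    \int[P]_w (p (f w) * l (X w))%:E = \int[P]_w (m (f w) * l (X w))%:E.
  move=> ml l0; apply/eqP; rewrite eq_le; apply/andP; split.
    apply: (le_integral_weight mX mX (mp f mf) (mm f mf) _ _ ml l0) => //.
      by move=> w /=.
    by move=> w /=.
    by move=> B mB; rewrite eqB.
  apply: (le_integral_weight mX mX (mm f mf) (mp f mf) _ _ ml l0) => //.
  by move=> w /=.
  by move=> w /=.
  by move=> B mB; rewrite eqB.
have mhX (k : S -> R) : measurable_fun setT k -> measurable_fun setT (k \o X).
  by move=> mk; exact: measurableT_comp.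
have mph : measurable_fun setT (p \o h) by exact: measurable_maxr.
have mmh : measurable_fun setT (m \o h).
  by apply: measurable_maxr => //; exact: measurableT_comp.
have mE (k : T -> R) (l : S -> R) : measurable_fun setT k -> measurable_fun setT l ->
    measurable_fun setT (fun w => (k w * l (X w))%:E).
  by move=> mk ml; apply/measurable_EFinP/measurable_funM => //; exact: mhX.
have Epos : \int[P]_w (p (f w * h (X w)))%:E =
    \int[P]_w (p (f w) * p (h (X w)))%:E + \int[P]_w (m (f w) * m (h (X w)))%:E.
  rewrite -ge0_integralD //; last 4 first.
  - by move=> w _; rewrite lee_fin mulr_ge0.
  - by apply: (mE (p \o f) (p \o h)) => //; exact: mp.
  - by move=> w _; rewrite lee_fin mulr_ge0.
  - by apply: (mE (m \o f) (m \o h)) => //; exact: mm.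
  apply: eq_integral => w _; rewrite -EFinD; congr (_%:E); rewrite /p /m.
  by case: (leP (f w) 0%R) => ?; case: (leP (h (X w)) 0%R) => ?;
    case: (leP (f w * h (X w))%R 0%R) => ?; case: (leP (- f w)%R 0%R) => ?;
    case: (leP (- h (X w))%R 0%R) => ?; nra.
have Eneg : \int[P]_w (m (f w * h (X w)))%:E =
    \int[P]_w (m (f w) * p (h (X w)))%:E + \int[P]_w (p (f w) * m (h (X w)))%:E.
  rewrite -ge0_integralD //; last 4 first.
  - by move=> w _; rewrite lee_fin mulr_ge0.
  - by apply: (mE (m \o f) (p \o h)) => //; exact: mm.
  - by move=> w _; rewrite lee_fin mulr_ge0.
  - by apply: (mE (p \o f) (m \o h)) => //; exact: mp.
  apply: eq_integral => w _; rewrite -EFinD; congr (_%:E); rewrite /p /m.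
  by case: (leP (f w) 0%R) => ?; case: (leP (h (X w)) 0%R) => ?;
    case: (leP (- (f w * h (X w)))%R 0%R) => ?; case: (leP (- f w)%R 0%R) => ?;
    case: (leP (- h (X w))%R 0%R) => ?; nra.
have fin := integrable_pos_fin_num measurableT ifh.
rewrite integralE Ep Em; rewrite Ep in fin.
have -> : \int[P]_x (m (f x * h (X x)))%:E = \int[P]_x (p (f x * h (X x)))%:E.
  rewrite Eneg Epos (eqk (p \o h) mph (fun s => p0 (h s))).
  by rewrite (eqk (m \o h) mmh (fun s => m0 (h s))).
by rewrite subee.
Qed.

End ConditionalMoments.

(** * The whitened design *)

Section Whitened.
Context {R : realType} {dT : measure_display} {T : measurableType dT}
  (P : probability T R) {d : nat}.
Variable X : {RV P >-> d.-tuple (measurableTypeR R)}.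

Lemma measurable_dot_vec (p : 'cV[R]_d) (M : 'M[R]_d) :
  measurable_fun setT
    (fun x : d.-tuple (measurableTypeR R) => dot p (M *m vec x)).
Proof.
have -> : (fun x : d.-tuple (measurableTypeR R) => dot p (M *m vec x)) =
    (fun x => \sum_(i < d) (M^T *m p) i 0 * tnth x i).
  apply/funext => x; rewrite dotC dot_mulmx dotC.
  by apply: eq_bigr => i _; rewrite [vec x i 0]mxE.
apply: measurable_sum => i; apply: measurable_funM => //.
exact: measurable_tnth.
Qed.

Lemma measurable_whiten (p : 'cV[R]_d) :
  measurable_fun setT (fun w => dot p (whiten X (X w))).
Proof.
exact: (measurableT_comp (measurable_dot_vec p _) (measurable_funPT X)).
Qed.

Hypothesis pdX : posdefmx (second_moment X).

(** A positive diagonal entry excludes an infinite second moment, whose fine part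
    is 0. *)
Lemma integrable_coord2 i j :
  P.-integrable setT (fun w => (tnth (X w) i * tnth (X w) j)%:E).
Proof.
have mX k : measurable_fun setT (fun w => tnth (X w) k : R).
  exact: (measurableT_comp (@measurable_tnth _ _ d k) (measurable_funPT X)).
have sq k : P.-integrable setT (fun w => (tnth (X w) k * tnth (X w) k)%:E).
  have ek : (delta_mx k 0 : 'cV[R]_d) != 0.
    apply/eqP => /matrixP /(_ k 0); rewrite !mxE !eqxx => /eqP.
    by rewrite oner_eq0.
  have := pdX.2 _ ek.
  have -> : dot (delta_mx k 0) (second_moment X *m delta_mx k 0) =
      second_moment X k k.
    rewrite dotE mxE (bigD1 k) //= big1 ?addr0; last first.
      by move=> l lk; rewrite !mxE (negbTE lk) mul0r.
    rewrite !mxE !eqxx mul1r (bigD1 k) //= big1 ?addr0; last first.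
      by move=> l lk; rewrite !mxE (negbTE lk) mulr0.
    by rewrite !mxE !eqxx mulr1.
  rewrite mxE => fin; apply/integrableP; split.
    by apply/measurable_EFinP; apply: measurable_funM.
  rewrite (eq_integral (fun w => (tnth (X w) k * tnth (X w) k)%:E)); last first.
    by move=> w _; rewrite gee0_abs // lee_fin -expr2 sqr_ge0.
  move: fin; set I := (integral _ _ _); case: I => [r _| |_] /=.
  - exact: ltry.
  - by rewrite (ltxx (0 : R)).
  - by [].
have sumsq := integrableD measurableT (sq i) (sq j).
apply: le_integrable sumsq => //.
  by apply/measurable_EFinP; apply: measurable_funM.
move=> w _ /=; rewrite lee_fin.
set x := tnth _ i; set y := tnth _ j.
rewrite (ger0_norm (_ : 0 <= x * x + y * y)); last by nra.
rewrite ler_norml; apply/andP; split; nra.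
Qed.

Lemma sqr_dot_vec (c : 'cV[R]_d) w :
  dot c (vec (X w)) ^+ 2 =
  \sum_(i < d) \sum_(j < d) c i 0 * c j 0 * (tnth (X w) i * tnth (X w) j).
Proof.
rewrite expr2 /dot big_distrl /=; apply: eq_bigr => i _.
rewrite big_distrr /=; apply: eq_bigr => j _; rewrite !mxE; ring.
Qed.

Lemma second_moment_dot (c : 'cV[R]_d) :
  P.-integrable setT (fun w => (dot c (vec (X w)) ^+ 2)%:E) /\
  (\int[P]_w (dot c (vec (X w)) ^+ 2)%:E = (dot c (second_moment X *m c))%:E)%E.
Proof.
have E : (fun w => (dot c (vec (X w)) ^+ 2)%:E) = (fun w =>
    \sum_(i < d) \sum_(j < d) (c i 0 * c j 0)%:E *
      (tnth (X w) i * tnth (X w) j)%:E)%E.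
  apply/funext => w; rewrite sqr_dot_vec -sumEFin; apply: eq_bigr => i _.
  by rewrite -sumEFin; apply: eq_bigr => j _; rewrite EFinM.
have intij i j : P.-integrable setT (fun w => ((c i 0 * c j 0)%:E *
      (tnth (X w) i * tnth (X w) j)%:E)%E).
  by apply: integrableZl => //; exact: integrable_coord2.
have inti i : P.-integrable setT (fun w => (\sum_(j < d) (c i 0 * c j 0)%:E *
      (tnth (X w) i * tnth (X w) j)%:E)%E).
  by apply: integrable_sum => // j _; exact: intij.
rewrite E; split; first by apply: integrable_sum => // i _; exact: inti.
rewrite integral_sum // /dot -sumEFin; apply: eq_bigr => i _.
rewrite integral_sum // mxE mulr_sumr -sumEFin; apply: eq_bigr => j _.
rewrite integralZl //; last exact: integrable_coord2.
rewrite -(fineK (integrable_fin_num measurableT (integrable_coord2 i j))).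
by rewrite -EFinM !mxE; congr (_%:E); ring.
Qed.

Lemma whitened_second_moment (p : 'cV[R]_d) :
  P.-integrable setT (fun w => (dot p (whiten X (X w)) ^+ 2)%:E) /\
  (\int[P]_w (dot p (whiten X (X w)) ^+ 2)%:E = (dot p p)%:E)%E.
Proof.
set S := inv_sqrtmx (second_moment X).
have [[symS _] _] := inv_sqrtmxP pdX.
have E w : dot p (whiten X (X w)) = dot (S *m p) (vec (X w)).
  by rewrite dot_mulmx symS.
have -> : (fun w => (dot p (whiten X (X w)) ^+ 2)%:E) =
          (fun w => (dot (S *m p) (vec (X w)) ^+ 2)%:E).
  by apply/funext => w; rewrite E.
have [int_ ->] := second_moment_dot (S *m p); split=> //.
by rewrite dot_mulmx symS !mulmxA inv_sqrtmx_conj // mul1mx.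
Qed.

Lemma whitened_exp_moment A0 (p : 'cV[R]_d) : 0 < A0 -> subgaussian_design X A0 ->
  l2norm p <= 2 ->
  (\int[P]_w (expR ((8 * A0 ^+ 2)^-1 * dot p (whiten X (X w)) ^+ 2))%:E
   <= (@gauss_moment R)%:E)%E.
Proof.
move=> A00 [_ tail] p2; have K1 := gauss_moment_ge1 R.
have [p0|p0] := eqVneq p 0.
  rewrite (eq_integral (fun=> 1%:E)); last first.
    by move=> w _; rewrite p0 dot0l expr0n mulr0 expR0.
  rewrite integral_cst // mul1e.
  by apply: (@le_trans _ _ 1%E); [rewrite probability_le1|rewrite lee_fin].
have np : 0 < l2norm p by rewrite sqrtr_gt0 dot_gt0.
pose u := (l2norm p)^-1 *: p.
have u1 : l2norm u = 1.
  by rewrite l2normZ gtr0_norm ?invr_gt0 // mulVf ?gt_eqF.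
have pu : p = l2norm p *: u by rewrite scalerA mulfV ?gt_eqF // scale1r.
pose U w := A0^-1 * dot u (whiten X (X w)).
have mU : measurable_fun setT U.
  by apply: measurable_funM => //; exact: measurable_whiten.
apply: le_trans (subgaussian_exp_sqr mU _).
  apply: ge0_le_integral => //.
  - apply/measurable_EFinP; apply: measurableT_comp => //; apply: measurable_funM => //.
    by apply: measurable_funX; exact: measurable_whiten.
  - apply/measurable_EFinP; apply: measurableT_comp => //; apply: measurable_funM => //.
    exact: measurable_funX.
  move=> w _; rewrite lee_fin ler_expR pu dotZl /U.
  set y := dot u _.
  have -> : (8 * A0 ^+ 2)^-1 * (l2norm p * y) ^+ 2 =
     2^-1 * (l2norm p ^+ 2 / 4) * (A0^-1 * y) ^+ 2 by field; lra.
  rewrite ler_wpM2r ?sqr_ge0 //; nra.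
move=> t t0; have := tail u t u1 t0.
congr (P _ <= _)%E; apply/funext => w; rewrite /= /U normrM.
by rewrite (gtr0_norm (_ : 0 < A0^-1)) ?invr_gt0 // ler_pdivlMl.
Qed.

End Whitened.

(** * Exponential moments of the three empirical processes *)

Lemma measurable_huber_score (R : realType) (tau : R) :
  measurable_fun setT (huber_score tau).
Proof. by apply: measurable_maxr => //; apply: measurable_minr. Qed.

Section Mgf.
Context {R : realType} {dT : measure_display} {T : measurableType dT}
  (P : probability T R) {d : nat}.
Context (X : {RV P >-> d.-tuple (measurableTypeR R)}) (Y : {RV P >-> R}).
Context (theta : 'cV[R]_d) (sigma delta ups A0 : R) (p : 'cV[R]_d).
Hypothesis A0_gt0 : 0 < A0.
Hypothesis subg : subgaussian_design X A0.
Hypothesis noise : noise_moments X Y theta sigma delta ups.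
Hypothesis ups_ge0 : 0 <= ups.
Hypothesis delta_ge0 : 0 <= delta.
Hypothesis p_le2 : l2norm p <= 2.

Let W w := dot p (whiten X (X w)).
Let eps := residual X Y theta.
Let s := (8 * A0 ^+ 2)^-1.
Let K := @gauss_moment R.

Let s_gt0 : 0 < s.
Proof. by rewrite invr_gt0 mulr_gt0 // exprn_gt0. Qed.

Let mX : measurable_fun setT X := measurable_funPT X.
Let mw : measurable_fun setT (fun x => dot p (whiten X x)) :=
  measurable_dot_vec p (inv_sqrtmx (second_moment X)).
Let mW : measurable_fun setT W := measurable_whiten X p.

Let meps : measurable_fun setT eps.
Proof. by case: noise => H _ _; exact: (measurable_cond_expectation H). Qed.

Lemma whitened_moment_le (h : R -> R) c : measurable_fun setT h ->
  (forall x, 0 <= h x <= c * expR (s * x ^+ 2)) -> 0 <= c ->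
  (\int[P]_w (h (W w))%:E <= (c * K)%:E)%E.
Proof.
move=> mh hb c0; have mG : measurable_fun setT (fun w => (expR (s * W w ^+ 2))%:E).
  apply/measurable_EFinP; apply: measurableT_comp => //; apply: measurable_funM => //.
  exact: measurable_funX.
apply: (@le_trans _ _ (\int[P]_w (c%:E * (expR (s * W w ^+ 2))%:E))%E).
  apply: ge0_le_integral => //.
  - by move=> w _; rewrite lee_fin; have /andP[] := hb (W w).
  - by apply/measurable_EFinP; exact: measurableT_comp.
  - exact: emeasurable_funM.
  - by move=> w _; rewrite -EFinM lee_fin; have /andP[] := hb (W w).
rewrite ge0_integralZl_EFin //.
by rewrite EFinM lee_wpmul2l ?lee_fin //; exact: whitened_exp_moment.
Qed.

Lemma eps_moment_le (h : R -> R) c : measurable_fun setT h ->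
  (forall x, 0 <= h x <= c * expR (s * x ^+ 2)) -> 0 <= c ->
  (\int[P]_w (`|eps w| `^ (2 + delta) * h (W w))%:E <= (ups * (c * K))%:E)%E.
Proof.
move=> mh hb c0; have [_ _ [g [cg gu]]] := noise.
apply: le_trans (cond_expectation_le cg mX _ ups_ge0 gu
  (measurableT_comp mh mw) _) _.
- by move=> w; exact: powR_ge0.
- by move=> x /=; have /andP[] := hb (dot p (whiten X x)).
by rewrite EFinM lee_wpmul2l ?lee_fin //; exact: whitened_moment_le.
Qed.

Lemma eps_sqr_le (h : R -> R) c : measurable_fun setT h ->
  (forall x, 0 <= h x <= c * expR (s * x ^+ 2)) -> 0 <= c ->
  (\int[P]_w (eps w ^+ 2 * h (W w))%:E <= (sigma ^+ 2 * (c * K))%:E)%E.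
Proof.
move=> mh hb c0; have [_ cg _] := noise.
have gu : {ae P, forall w, (cst (sigma ^+ 2) : T -> R) w <= sigma ^+ 2}.
  by apply: aeW => w /=.
apply: le_trans (cond_expectation_le cg mX _ (sqr_ge0 sigma) gu
  (measurableT_comp mh mw) _) _.
- by move=> w; exact: sqr_ge0.
- by move=> x /=; have /andP[] := hb (dot p (whiten X x)).
by rewrite [leRHS]EFinM lee_wpmul2l ?lee_fin ?sqr_ge0 //; exact: whitened_moment_le.
Qed.

Lemma integrable_eps_whitened : P.-integrable setT (fun w => (eps w * W w)%:E).
Proof.
have [_ [ieps2 _ _ _] _] := noise.
have [iW2 _] := whitened_second_moment subg.1 p.
apply: le_integrable (integrableD measurableT ieps2 iW2) => //.
  by apply/measurable_EFinP; exact: measurable_funM.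
move=> w _ /=; rewrite lee_fin (ger0_norm (_ : 0 <= eps w ^+ 2 + W w ^+ 2)).
  rewrite ler_norml; apply/andP; split; nra.
by rewrite addr_ge0 ?sqr_ge0.
Qed.

Definition score_mgf_const (a : R) : R :=
  let s := (8 * a ^+ 2)^-1 in
  (1 + s^-1 + 4 * s^-1 * expR (2 * s)^-1) * @gauss_moment R.

(** Replacing the truncated residual by eps makes the linear term centered; the
    price is a bias controlled by the moment of order 2 + delta, while the
    variance of eps controls the quadratic term since lam tau <= 1. *)
Lemma score_mgf (lam tau rho : R) : 0 <= lam -> 0 < tau -> lam * tau <= 1 ->
  lam ^+ 2 * sigma ^+ 2 <= 2 * rho ->
  lam * tau `^ (- (1 + delta)) * ups <= rho ->
  (\int[P]_w (expR (lam * (huber_score tau (eps w) * W w)))%:E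
    <= (expR (score_mgf_const A0 * rho))%:E)%E.
Proof.
move=> lam0 tau0 lamtau lamsig lamups.
pose b := lam * tau `^ (- (1 + delta)).
have b0 : 0 <= b by rewrite mulr_ge0 ?powR_ge0.
pose h1 (x : R) := x ^+ 2 * expR `|x|.
have mh1 : measurable_fun setT h1.
  apply: measurable_funM => //; apply: measurableT_comp => //.
pose r w := b * (`|eps w| `^ (2 + delta) * `|W w|) +
            lam ^+ 2 * (eps w ^+ 2 * h1 (W w)).
have c1 : 0 <= 1 + s^-1 by rewrite addr_ge0 // invr_ge0 ltW.
have c2 : 0 <= 2 * s^-1 * expR (2 * s)^-1.
  by rewrite mulr_ge0 ?expR_ge0 // mulr_ge0 // invr_ge0 (ltW s_gt0).
have K0 : 0 <= K by apply: le_trans (gauss_moment_ge1 R).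
have mea : measurable_fun setT (fun w => `|eps w| `^ (2 + delta)).
  apply: (measurableT_comp (measurable_powR (2 + delta))); exact: measurableT_comp.
have mr1 : measurable_fun setT (fun w => `|eps w| `^ (2 + delta) * `|W w|).
  by apply: measurable_funM => //; exact: measurableT_comp.
have mr2 : measurable_fun setT (fun w => eps w ^+ 2 * h1 (W w)).
  by apply: measurable_funM; [exact: measurable_funX|exact: measurableT_comp].
have r10 w : 0 <= `|eps w| `^ (2 + delta) * `|W w| by rewrite mulr_ge0 ?powR_ge0.
have h10 x : 0 <= h1 x by rewrite mulr_ge0 ?sqr_ge0 ?expR_ge0.
have r20 w : 0 <= eps w ^+ 2 * h1 (W w) by rewrite mulr_ge0 ?sqr_ge0.
have l0 := sqr_ge0 lam.
apply: (@exp_moment_le _ _ _ P _ (fun w => lam * (eps w * W w)) r) => //.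
- apply: measurable_funM => //; apply: measurable_funM => //.
  exact: (measurableT_comp (measurable_huber_score tau) meps).
- have -> : (EFin \o (fun w => lam * (eps w * W w))) =
      (fun w => lam%:E * (eps w * W w)%:E)%E by apply/funext => w; rewrite /= EFinM.
  by apply: integrableZl => //; exact: integrable_eps_whitened.
- under eq_integral do rewrite EFinM.
  rewrite integralZl //; last exact: integrable_eps_whitened.
  have [c0 _ _] := noise.
  by rewrite (cond_centered c0 mX mw integrable_eps_whitened) mule0.
- by apply: measurable_funD; apply: measurable_funM.
- by move=> w; rewrite addr_ge0 // mulr_ge0.
- rewrite /r; under eq_integral do rewrite EFinD.
  rewrite ge0_integralD //; last 4 first.
  + by move=> w _; rewrite lee_fin mulr_ge0.
  + by apply/measurable_EFinP/measurable_funM.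
  + by move=> w _; rewrite lee_fin mulr_ge0.
  + by apply/measurable_EFinP/measurable_funM.
  under eq_integral do rewrite EFinM.
  under [X in (_ + X <= _)%E]eq_integral do rewrite EFinM.
  rewrite !ge0_integralZl_EFin ?sqr_ge0 //; last 3 first.
  + by move=> w _; rewrite lee_fin.
  + exact/measurable_EFinP.
  + exact/measurable_EFinP.
  have I1 := eps_moment_le (@normr_measurable R setT)
    (fun x => introT andP (conj (normr_ge0 x) (norm_le_expR x s_gt0))) c1.
  have I2 := eps_sqr_le mh1
    (fun x => introT andP (conj (h10 x) (sqr_expR_norm_le x s_gt0))) c2.
  apply: le_trans (leeD (lee_wpmul2l _ I1) (lee_wpmul2l _ I2)) _.
  + by rewrite lee_fin.
  + by rewrite lee_fin sqr_ge0.
  rewrite -!EFinM -EFinD lee_fin /score_mgf_const -/s -/K.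
  rewrite [leRHS](_ : _ = rho * ((1 + s^-1) * K) +
      2 * rho * (2 * s^-1 * expR (2 * s)^-1 * K)); last by ring.
  have k1 : 0 <= (1 + s^-1) * K by rewrite mulr_ge0.
  have k2 : 0 <= 2 * s^-1 * expR (2 * s)^-1 * K by rewrite mulr_ge0.
  apply: lerD; first by rewrite [leLHS]mulrA ler_wpM2r.
  by rewrite [leLHS]mulrA ler_wpM2r.
move=> w; set psi := huber_score tau (eps w); rewrite /r.
apply: le_trans (expR_le_taylor _) _; rewrite -addrA -[leRHS]addrA lerD2l.
have psi_tau := huber_score_bound tau0 (eps w).
have psi_eps := huber_score_le tau0 (eps w).
have err := huber_score_err (eps w) tau0 delta_ge0.
rewrite -/psi in psi_tau psi_eps err.
rewrite addrA; apply: lerD.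
  have -> : lam * (psi * W w) = lam * (eps w * W w) + lam * (- (eps w - psi) * W w).
    by ring.
  rewrite lerD2l /b -[X in _ <= X]mulrA ler_wpM2l //.
  apply: le_trans (ler_norm _) _; rewrite normrM normrN [leRHS]mulrA.
  by rewrite ler_wpM2r // [leRHS]mulrC.
have N1 : `|lam * (psi * W w)| <= `|W w|.
  rewrite !normrM (ger0_norm lam0) mulrA -[leRHS]mul1r ler_wpM2r //.
  by apply: le_trans lamtau; rewrite ler_wpM2l.
rewrite !exprMn -mulrA ler_wpM2l // /h1 -mulrA.
apply: ler_pM; [exact: sqr_ge0|by rewrite mulr_ge0 ?sqr_ge0 ?expR_ge0| |].
  rewrite -(real_normK (num_real psi)) -(real_normK (num_real (eps w))).
  by rewrite lerXn2r ?nnegrE.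
by rewrite ler_wpM2l ?sqr_ge0 // ler_expR.
Qed.

Definition quad_mgf_const (a : R) : R :=
  4 * expR (4 * (8 * a ^+ 2)^-1) * @gauss_moment R.

Lemma quad_mgf (a q : R) : `|a| <= 1 -> 0 <= q <= 1 ->
  (\int[P]_w (expR (a * (s / 2 * q) * (W w ^+ 2 - dot p p)))%:E
    <= (expR (quad_mgf_const A0 * q ^+ 2))%:E)%E.
Proof.
move=> a1 /andP[q0 q1]; have s0 := s_gt0.
have K0 : 0 <= K by apply: le_trans (gauss_moment_ge1 R).
have [iW2 EW2] := whitened_second_moment subg.1 p.
pose c := a * (s / 2 * q).
pose r w := q ^+ 2 * (4 * expR (4 * s)) * expR (s * W w ^+ 2).
have mr : measurable_fun setT (fun w => expR (s * W w ^+ 2)).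
  apply: measurableT_comp => //; apply: measurable_funM => //.
  exact: measurable_funX.
have pp4 : dot p p <= 4.
  by rewrite -sqr_l2norm; have := l2norm_ge0 p; move: p_le2; nra.
have icst : P.-integrable setT (EFin \o cst (dot p p)).
  exact: finite_measure_integrable_cst.
have iD := integrableB measurableT iW2 icst.
have E0 : (EFin \o (fun w => c * (W w ^+ 2 - dot p p))) =
    (fun w => c%:E * ((fun w => (W w ^+ 2)%:E) \- (EFin \o cst (dot p p))) w)%E.
  by apply/funext => w; rewrite /= EFinM EFinB.
apply: (@exp_moment_le _ _ _ P _ (fun w => c * (W w ^+ 2 - dot p p)) r) => //.
- apply: measurable_funM => //; apply: measurable_funB => //.
  exact: measurable_funX.
- by rewrite E0; exact: integrableZl.
- transitivity (\int[P]_w (EFin \o (fun w => (c * (W w ^+ 2 - dot p p))%R)) w)%E => //.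
  rewrite E0 integralZl // integralB //.
  rewrite [X in (_ * (X - _))%E]EW2.
  rewrite [X in (_ * (_ - X))%E](_ : _ = (dot p p)%:E); last first.
    rewrite (eq_integral (fun=> (dot p p)%:E)) // integral_cst //.
    by rewrite -[RHS]mule1; congr (_ * _)%E; exact: probability_setT.
  by rewrite subee // mule0.
- by apply: measurable_funM.
- move=> w; rewrite /r; apply: mulr_ge0; last exact: expR_ge0.
  by rewrite mulr_ge0 ?sqr_ge0 // mulr_ge0 ?expR_ge0.
- under eq_integral do rewrite EFinM.
  have c0 : 0 <= q ^+ 2 * (4 * expR (4 * s)).
    by rewrite mulr_ge0 ?sqr_ge0 // mulr_ge0 ?expR_ge0.
  rewrite ge0_integralZl_EFin //; last exact/measurable_EFinP.
  apply: le_trans (lee_wpmul2l _ (whitened_exp_moment A0_gt0 subg p_le2)) _.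
    by rewrite lee_fin.
  rewrite -EFinM lee_fin /quad_mgf_const le_eqVlt -/s -/K; apply/orP; left.
  by apply/eqP; ring.
move=> w; apply: le_trans (expR_le_taylor _) _; rewrite -/c lerD2l.
set D := W w ^+ 2 - dot p p; pose y := s / 2 * (W w ^+ 2 + 4).
have y0 : 0 <= y by rewrite mulr_ge0 ?addr_ge0 ?sqr_ge0 //; lra.
have cD : `|c * D| <= q * y.
  have sq : 0 <= s / 2 * q by rewrite mulr_ge0 //; lra.
  rewrite /c normrM [X in X * _]normrM (ger0_norm sq).
  have D4 : `|D| <= W w ^+ 2 + 4.
    rewrite ler_norml /D; apply/andP.
    by have := dot_ge0 p; have := sqr_ge0 (W w); split; lra.
  rewrite /y -mulrA.
  have H1 : s / 2 * q * `|D| <= s / 2 * q * (W w ^+ 2 + 4) by rewrite ler_wpM2l.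
  have H2 : `|a| * (s / 2 * q * `|D|) <= s / 2 * q * `|D|.
    by rewrite -[leRHS]mul1r ler_wpM2r // mulr_ge0.
  by apply: le_trans H2 _; lra.
have cD2 : (c * D) ^+ 2 <= q ^+ 2 * (4 * expR y).
  rewrite -(real_normK (num_real (c * D))).
  apply: (@le_trans _ _ ((q * y) ^+ 2)).
    by rewrite lerXn2r ?nnegrE ?(mulr_ge0 q0 y0).
  by rewrite exprMn ler_wpM2l ?sqr_ge0 // sqr_le_expR_lin.
have cDy : expR `|c * D| <= expR y.
  by rewrite ler_expR; apply: le_trans cD _; rewrite -[leRHS]mul1r ler_wpM2r.
apply: le_trans (ler_pM (sqr_ge0 _) (expR_ge0 _) cD2 cDy) _.
rewrite /r -!mulrA -!expRD; do 2 (rewrite ler_wpM2l ?sqr_ge0 //).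
by rewrite ler_wpM2l // ler_expR /y; lra.
Qed.

(** This dominates x^2 when big holds or M < |x|.  The truncation is smoothed to
    2 |x| - M in order to stay convex in x, which the net argument requires. *)
Definition defect (big : bool) (M x : R) : R :=
  (Num.max 0 (2 * `|x| - (if big then 0 else M))) ^+ 2.

Lemma defectP big M x : 0 < M ->
  defect big M x <= 4 * x ^+ 2 /\
  (~~ big -> 2 * `|x| <= M -> defect big M x = 0).
Proof.
move=> M0; rewrite /defect; split.
  rewrite -(real_normK (num_real x)); have n0 := normr_ge0 x.
  by case: big; case: (lerP 0 _) => ?; nra.
move=> /negbTE -> xM; have H : 2 * `|x| - M <= 0 by lra.
by rewrite (max_idPl H) expr0n.
Qed.

Lemma measurable_defect M tau (e w : T -> R) :
  measurable_fun setT e -> measurable_fun setT w ->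
  measurable_fun setT (fun t => defect (tau < `|e t|) M (w t)).
Proof.
move=> me mw'; apply: measurable_funX; apply: measurable_maxr => //.
apply: measurable_funB.
  by apply: measurable_funM => //; exact: measurableT_comp.
apply: measurable_fun_ifT => //; apply: measurable_fun_ltr => //.
exact: measurableT_comp.
Qed.

(** The exponent vanishes unless the residual or W is large; the first event has
    conditional probability of order rho, the second one costs a factor
    4 W^2 / M^2. *)
Lemma defect_mgf (M tau rho : R) : 0 < M -> 0 < tau -> 0 <= rho ->
  ups * (tau / 2) `^ (- (2 + delta)) <= 2 `^ (2 + delta) * rho ->
  forall k, M ^- 2 <= k * rho ->
  (\int[P]_w (expR (s / 8 * defect (tau / 2 < `|eps w|) M (W w)))%:E
    <= (expR ((2 `^ (2 + delta) + 8 / s * k) * K * rho))%:E)%E.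
Proof.
move=> M0 tau0 rho0 upsrho k krho; have s0 := s_gt0.
have K0 : 0 <= K by apply: le_trans (gauss_moment_ge1 R).
pose h2 (x : R) := expR (s / 2 * x ^+ 2).
pose h3 (x : R) := x ^+ 2 * expR (s / 2 * x ^+ 2).
have mh2 : measurable_fun setT h2.
  apply: measurableT_comp => //; apply: measurable_funM => //.
have mh3 : measurable_fun setT h3 by apply: measurable_funM => //.
have h2b x : 0 <= h2 x <= 1 * expR (s * x ^+ 2).
  rewrite expR_ge0 mul1r ler_expR /=; have := sqr_ge0 x; nra.
have h3b x : 0 <= h3 x <= 2 / s * expR (s * x ^+ 2).
  rewrite /h3 mulr_ge0 ?sqr_ge0 ?expR_ge0 //=.
  have -> : s * x ^+ 2 = s / 2 * x ^+ 2 + s / 2 * x ^+ 2 by lra.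
  rewrite expRD [leRHS]mulrA ler_wpM2r ?expR_ge0 //.
  by have := sqr_le_expR x (_ : 0 < s / 2); rewrite invf_div; apply; lra.
pose b := (tau / 2) `^ (- (2 + delta)).
have b0 : 0 <= b by exact: powR_ge0.
have M20 : 0 <= 4 * M ^- 2 by rewrite mulr_ge0 // invr_ge0 sqr_ge0.
pose r w := b * (`|eps w| `^ (2 + delta) * h2 (W w)) + 4 * M ^- 2 * h3 (W w).
have mea : measurable_fun setT (fun w => `|eps w| `^ (2 + delta)).
  apply: (measurableT_comp (measurable_powR (2 + delta))); exact: measurableT_comp.
have mr1 : measurable_fun setT (fun w => `|eps w| `^ (2 + delta) * h2 (W w)).
  by apply: measurable_funM => //; exact: measurableT_comp.
have mr2 : measurable_fun setT (fun w => h3 (W w)) by exact: measurableT_comp.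
have h20 x : 0 <= h2 x by have /andP[] := h2b x.
have h30 x : 0 <= h3 x by have /andP[] := h3b x.
have r10 w : 0 <= `|eps w| `^ (2 + delta) * h2 (W w) by rewrite mulr_ge0 ?powR_ge0.
apply: (@exp_moment_le _ _ _ P _ (fun=> 0) r) => //.
- by apply: measurable_funM => //; exact: measurable_defect.
- exact: integrable0.
- exact: integral0.
- by apply: measurable_funD; apply: measurable_funM.
- by move=> w; rewrite addr_ge0 // mulr_ge0.
- rewrite /r; under eq_integral do rewrite EFinD.
  rewrite ge0_integralD //; last 4 first.
  + by move=> w _; rewrite lee_fin mulr_ge0.
  + by apply/measurable_EFinP/measurable_funM.
  + by move=> w _; rewrite lee_fin mulr_ge0.
  + by apply/measurable_EFinP/measurable_funM.
  under eq_integral do rewrite EFinM.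
  under [X in (_ + X <= _)%E]eq_integral do rewrite EFinM.
  rewrite !ge0_integralZl_EFin //; last 4 first.
  + by move=> w _; rewrite lee_fin.
  + exact/measurable_EFinP.
  + by move=> w _; rewrite lee_fin.
  + exact/measurable_EFinP.
  have I1 := eps_moment_le mh2 h2b ler01.
  have s20 : 0 <= 2 / s by rewrite divr_ge0 // ltW.
  have I2 := whitened_moment_le mh3 h3b s20.
  apply: le_trans (leeD (lee_wpmul2l _ I1) (lee_wpmul2l _ I2)) _.
  + by rewrite lee_fin.
  + by rewrite lee_fin.
  rewrite -!EFinM -EFinD lee_fin.
  have H1 : ups * b * K <= 2 `^ (2 + delta) * rho * K by rewrite ler_wpM2r.
  have H2 : M ^- 2 * (8 / s * K) <= k * rho * (8 / s * K).
    by rewrite ler_wpM2r // mulr_ge0 // divr_ge0 // ltW.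
  have -> : b * (ups * (1 * K)) + 4 * M ^- 2 * (2 / s * K) =
    ups * b * K + M ^- 2 * (8 / s * K) by field; rewrite ?gt_eqF.
  apply: le_trans (lerD H1 H2) _.
  by rewrite le_eqVlt; apply/orP; left; apply/eqP; ring.
move=> w; rewrite addr0 /r.
have [D1 D2] := defectP (tau / 2 < `|eps w|) (W w) M0.
have X1 : expR (s / 8 * defect (tau / 2 < `|eps w|) M (W w)) <= h2 (W w).
  rewrite ler_expR; nra.
have A1 : 0 <= b * (`|eps w| `^ (2 + delta) * h2 (W w)) by rewrite mulr_ge0.
have A2 : 0 <= 4 * M ^- 2 * h3 (W w) by rewrite mulr_ge0.
have [big|small] := boolP (tau / 2 < `|eps w|).
  have t20 : 0 < tau / 2 by lra.
  have := tail_indicator_le (eps w) t20 delta_ge0; rewrite big -/b => H.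
  have : h2 (W w) <= b * (`|eps w| `^ (2 + delta) * h2 (W w)).
    rewrite mulrA [b * _]mulrC -[leLHS]mul1r ler_wpM2r //.
  move: X1; rewrite big; lra.
have [WM|WM] := lerP (2 * `|W w|) M.
  by have := D2 small WM; rewrite (negbTE small) => ->; rewrite mulr0 expR0; lra.
have : h2 (W w) <= 4 * M ^- 2 * h3 (W w).
  rewrite /h3 mulrA -[leLHS]mul1r ler_wpM2r //.
  rewrite mulrAC ler_pdivlMr ?exprn_gt0 // mul1r -(real_normK (num_real (W w))).
  have := normr_ge0 (W w); nra.
move: X1; rewrite (negbTE small); lra.
Qed.

End Mgf.

(** * The excess risk as a perturbed quadratic maximum *)

Section Deterministic.
Context {R : realType} (n d : nat) (tau : R) (eps : 'I_n -> R)
  (z : 'I_n -> 'cV[R]_d).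

Definition risk_gain (w : 'cV[R]_d) : R :=
  \sum_(i < n) (huber tau (eps i) - huber tau (eps i - dot (z i) w)).

Definition score_sum : 'cV[R]_d := \sum_(i < n) huber_score tau (eps i) *: z i.

Lemma dot_score_sum w :
  dot w score_sum = \sum_(i < n) huber_score tau (eps i) * dot (z i) w.
Proof.
by rewrite dot_sumr; apply: eq_bigr => i _; rewrite dotZr dotC.
Qed.

Lemma risk_gain_ge w : 0 < tau ->
  dot w score_sum - 2^-1 * \sum_(i < n) dot (z i) w ^+ 2 <= risk_gain w.
Proof.
move=> tau0; rewrite dot_score_sum mulr_sumr -sumrB ler_sum // => i _.
have [H _] := huber_gap tau0 (eps i) (dot (z i) w); lra.
Qed.

Lemma risk_gain_scale s w : 0 < tau -> 0 <= s <= 1 ->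
  s * risk_gain w <= risk_gain (s *: w).
Proof.
move=> tau0 s01; rewrite mulr_sumr ler_sum // => i _.
have := huber_convex tau0 (eps i) (- dot (z i) w) s01.
by rewrite mulrN dotZr; lra.
Qed.

(** On the ball of radius r a shift above tau / 2 forces |<z, e>| > M in the
    direction e of w. *)
Lemma risk_gain_le M r B3 w : 0 < tau -> 0 < M -> 2 * r * M <= tau ->
  l2norm w <= r ->
  (forall u, l2norm u <= 1 ->
     \sum_(i < n) defect (tau / 2 < `|eps i|) M (dot (z i) u) <= B3) ->
  risk_gain w <= dot w score_sum - 2^-1 * \sum_(i < n) dot (z i) w ^+ 2 +
                 2^-1 * (l2norm w ^+ 2 * B3).
Proof.
move=> tau0 M0 rM wr HB3.
have [e [e1 we]] := ball_normalize w.
set a := l2norm w in we *; have a0 : 0 <= a := l2norm_ge0 w.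
have := ler_wpM2l (sqr_ge0 a) (HB3 e e1) => H.
apply: (@le_trans _ _ (dot w score_sum - 2^-1 * \sum_(i < n) dot (z i) w ^+ 2 +
  2^-1 * (a ^+ 2 * \sum_(i < n) defect (tau / 2 < `|eps i|) M (dot (z i) e))));
  last by lra.
rewrite dot_score_sum !mulr_sumr -sumrB -big_split /= ler_sum // => i _.
have [_ gap] := huber_gap tau0 (eps i) (dot (z i) w).
have hx : dot (z i) w = a * dot (z i) e by rewrite we dotZr.
suff : (if (tau / 2 < `|eps i|) || (tau / 2 < `|dot (z i) w|)
    then dot (z i) w ^+ 2 / 2 else 0) <=
  2^-1 * (a ^+ 2 * defect (tau / 2 < `|eps i|) M (dot (z i) e)) by lra.
rewrite hx normrM (ger0_norm a0) exprMn; set x := dot (z i) e.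
have a20 := sqr_ge0 a; have n0 := normr_ge0 x.
rewrite -(real_normK (num_real x)).
have pos b : 0 <= defect b M x by exact: sqr_ge0.
have [big|small] := boolP (tau / 2 < `|eps i|) => /=.
  have : `|x| ^+ 2 <= defect true M x.
    by rewrite /defect subr0 (max_idPr _) ?mulr_ge0 //; nra.
  move=> D; have := ler_wpM2l a20 D; lra.
case: ifP => [ax|_]; last by rewrite mulr_ge0 ?invr_ge0 // mulr_ge0.
have Mx : M < `|x|.
  rewrite ltNge; apply/negP => xM.
  have : a * `|x| <= r * M by rewrite ler_pM.
  lra.
have : `|x| ^+ 2 <= defect false M x.
  rewrite /defect (max_idPr _); first by nra.
  by apply: ltW; lra.
move=> D; have := ler_wpM2l a20 D; lra.
Qed.

(** With k = (B2 + B3) / n, the risk gain is squeezed between the quadratics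
    <w, S> - n (1 +- k) |w|^2 / 2 on the ball of radius r, and concavity together
    with 4 B1 <= n r keeps its maximum from exceeding what this ball allows. *)
Lemma excess_sandwich M r B1 B2 B3 E wh : (0 < n)%N ->
  0 < tau -> 0 < M -> 0 < r -> 2 * r * M <= tau ->
  l2norm score_sum <= B1 -> 4 * B1 <= n%:R * r ->
  (forall u, `|\sum_(i < n) dot (z i) u ^+ 2 - n%:R * l2norm u ^+ 2|
             <= B2 * l2norm u ^+ 2) ->
  (forall u, l2norm u <= 1 ->
     \sum_(i < n) defect (tau / 2 < `|eps i|) M (dot (z i) u) <= B3) ->
  0 <= B2 -> 0 <= B3 -> 2 * (B2 + B3) <= n%:R ->
  E = risk_gain wh -> (forall w, risk_gain w <= E) ->
  (1 - (B2 + B3) / n%:R) * (l2norm score_sum ^+ 2 / n%:R) <= 2 * E /\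
  2 * E * (1 - (B2 + B3) / n%:R) <= l2norm score_sum ^+ 2 / n%:R.
Proof.
move=> n0 tau0 M0 r0 rM S1 B1r Hq Hd B20 B30 Bn EE Emax.
have N0 : (0 : R) < n%:R by rewrite ltr0n.
set N := n%:R in N0 Bn B1r Hq *.
set S := score_sum in S1 *; set b := l2norm S in S1 *.
have b0 : 0 <= b := l2norm_ge0 S.
set kap := (B2 + B3) / N.
have kapN : kap * N = B2 + B3 by rewrite divfK // gt_eqF.
have kap2 : kap <= 2^-1 by rewrite ler_pdivrMr //; lra.
have kap0 : 0 <= kap by rewrite divr_ge0 ?addr_ge0 // ltW.
have upper w : l2norm w <= r ->
    risk_gain w <= l2norm w * b - 2^-1 * (1 - kap) * N * l2norm w ^+ 2.
  move=> wr; apply: le_trans (risk_gain_le tau0 M0 rM wr Hd) _.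
  have /ler_normlP[H1 _] := Hq w.
  have := cauchy_schwarz w S; rewrite -/b.
  have kE : N - (B2 + B3) = (1 - kap) * N by rewrite mulrBl kapN mul1r.
  move: H1; set q := \sum_(i < n) _; set l := l2norm w ^+ 2; rewrite -/S.
  have -> : 2^-1 * (1 - kap) * N * l = 2^-1 * ((N - (B2 + B3)) * l).
    by rewrite kE; ring.
  lra.
split.
  (* N^-1 *: S maximizes the unperturbed quadratic *)
  apply: (@le_trans _ _ (2 * risk_gain (N^-1 *: S))); last by rewrite ler_pM2l.
  apply: (@le_trans _ _ (2 * (dot (N^-1 *: S) S -
      2^-1 * \sum_(i < n) dot (z i) (N^-1 *: S) ^+ 2))); last first.
    by rewrite ler_pM2l // risk_gain_ge.
  have /ler_normlP[_ H2] := Hq (N^-1 *: S).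
  move: H2; rewrite l2normZ (gtr0_norm (_ : 0 < N^-1)) ?invr_gt0 // -/b.
  rewrite dotZl -sqr_l2norm -/b.
  set q := \sum_(i < n) _ => H2.
  have H3 : q <= (N + B2) * (N^-1 * b) ^+ 2 by lra.
  have E1 : (N + B2) * (N^-1 * b) ^+ 2 = (1 + B2 / N) * (b ^+ 2 / N).
    by field; rewrite gt_eqF.
  have B2k : B2 / N <= kap by rewrite ler_pM2r ?invr_gt0 //; lra.
  have b2N : 0 <= b ^+ 2 / N by rewrite divr_ge0 ?sqr_ge0 // ltW.
  have E2 : N^-1 * b ^+ 2 = b ^+ 2 / N by rewrite mulrC.
  rewrite E1 in H3; rewrite E2; nra.
have b2N : 0 <= b ^+ 2 / N by rewrite divr_ge0 ?sqr_ge0 // ltW.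
(* outside the ball, concavity along the segment from 0 brings wh back to the
   sphere of radius r, where the upper quadratic is at most 0 *)
rewrite EE; have [whr|whr] := lerP (l2norm wh) r.
  have := upper wh whr; set l := l2norm wh => H.
  have : 0 <= (b - (1 - kap) * N * l) ^+ 2 / N by rewrite divr_ge0 ?sqr_ge0 // ltW.
  have -> : (b - (1 - kap) * N * l) ^+ 2 / N =
    b ^+ 2 / N - (1 - kap) * 2 * (l * b - 2^-1 * (1 - kap) * N * l ^+ 2).
    by field; rewrite gt_eqF.
  have k1 : 0 <= (1 - kap) * 2 by lra.
  have := ler_wpM2l k1 H; lra.
suff : risk_gain wh <= 0 by nra.
have wh0 : 0 < l2norm wh by lra.
pose s := r / l2norm wh.
have s01 : 0 <= s <= 1.
  by rewrite divr_ge0 ?(ltW r0) ?(ltW wh0) //= ler_pdivrMr // mul1r ltW.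
have sw : l2norm (s *: wh) = r.
  by rewrite l2normZ ger0_norm ?divfK ?gt_eqF //; case/andP: s01.
have := upper (s *: wh); rewrite sw => /(_ (lexx r)) H.
have := risk_gain_scale wh tau0 s01 => H1.
have s0 : 0 < s by rewrite divr_gt0.
rewrite -(pmulr_rle0 _ s0); apply: (le_trans H1); apply: (le_trans H).
have Nrr : 0 <= N * r * r by rewrite mulr_ge0 ?(ltW r0) // mulr_ge0 // ltW.
have : N * r * r <= 2 * (1 - kap) * (N * r * r) by nra.
have rb : r * (4 * b) <= r * (N * r) by rewrite ler_pM2l //; lra.
rewrite expr2; lra.
Qed.

(** For the square root, |y - xi| xi <= |y - xi| (y + xi) = |y^2 - xi^2|. *)
Lemma excess_estimates kap xi (E : R) : 0 <= kap <= 2^-1 -> 0 <= xi ->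
  (1 - kap) * xi ^+ 2 <= 2 * E -> 2 * E * (1 - kap) <= xi ^+ 2 ->
  `|E - 2^-1 * xi ^+ 2| <= kap * xi ^+ 2 /\
  `|Num.sqrt (2 * E) - xi| <= 2 * kap * xi.
Proof.
move=> /andP[k0 k2] xi0 H1 H2; have x2 := sqr_ge0 xi.
have E0 : 0 <= 2 * E by apply: le_trans H1; rewrite mulr_ge0 //; lra.
have H3 : 2 * E <= (1 + 2 * kap) * xi ^+ 2 by nra.
have key : `|2 * E - xi ^+ 2| <= 2 * kap * xi ^+ 2.
  by rewrite ler_norml; apply/andP; split; nra.
split.
  move: key; rewrite !ler_norml => /andP[? ?]; apply/andP; split; lra.
set y := Num.sqrt (2 * E); have y0 : 0 <= y := sqrtr_ge0 _.
have yy : y ^+ 2 = 2 * E by rewrite sqr_sqrtr.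
rewrite -yy in key.
have [xi00|xin0] := eqVneq xi 0.
  move: key; rewrite xi00 expr0n /= mulr0 subr0 normr_le0 sqrf_eq0 => /eqP ->.
  by rewrite subr0 normr0.
have xip : 0 < xi by rewrite lt_neqAle eq_sym xin0.
have kE : 2 * kap * xi * xi = 2 * kap * xi ^+ 2 by ring.
rewrite -(ler_pM2r xip) kE; apply: le_trans key.
rewrite subr_sqr normrM ler_wpM2l // ger0_norm; lra.
Qed.

End Deterministic.

(** * Measurability of the optimal value *)

Section Measurability.
Context {R : realType} {dT : measure_display} {T : measurableType dT}
  (P : probability T R) {n d : nat}.
Variables (Xs : 'I_n -> {RV P >-> d.-tuple (measurableTypeR R)})
  (Ys : 'I_n -> {RV P >-> R}).

Let L tau theta w := huber_objective tau (fun i => vec (Xs i w))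
  (fun i => Ys i w) theta.

Lemma measurable_residual (X : {RV P >-> d.-tuple (measurableTypeR R)})
    (Y : {RV P >-> R}) (theta : 'cV[R]_d) :
  measurable_fun setT (residual X Y theta).
Proof.
apply: measurable_funB; first exact: measurable_funPT.
have -> : (fun w => dot (vec (X w)) theta) =
    (fun x : d.-tuple (measurableTypeR R) => dot theta (1%:M *m vec x)) \o X.
  by apply/funext => w /=; rewrite mul1mx dotC.
exact: (measurableT_comp (measurable_dot_vec theta _) (measurable_funPT X)).
Qed.

Lemma measurable_huber (tau : R) : 0 < tau -> measurable_fun setT (huber tau).
Proof.
move=> tau0; apply: continuous_measurable_fun => x.
apply/cvgrPdist_le => e e0; near=> y.
apply: le_trans (huber_lipschitz tau0 x y) _.
rewrite -ler_pdivlMl //.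
by near: y; apply: cvgr_dist_le => //; rewrite mulr_gt0 ?invr_gt0.
Unshelve. all: by end_near.
Qed.

Lemma measurable_objective (tau : R) theta : 0 < tau ->
  measurable_fun setT (L tau theta).
Proof.
move=> tau0; apply: measurable_sum => i.
apply: (measurableT_comp (measurable_huber tau0)).
exact: measurable_residual.
Qed.

Lemma huber_objective_lipschitz (tau : R) (x : 'I_n -> 'cV[R]_d) y
    (theta theta' : 'cV[R]_d) c : 0 < tau ->
  (forall j, `|theta j 0 - theta' j 0| <= c) ->
  `|huber_objective tau x y theta - huber_objective tau x y theta'| <=
  tau * (\sum_(i < n) \sum_(j < d) `|x i j 0|) * c.
Proof.
move=> tau0 H; rewrite -sumrB; apply: le_trans (ler_norm_sum _ _ _) _.
rewrite -mulrA mulr_suml mulr_sumr ler_sum // => i _.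
apply: le_trans (huber_lipschitz tau0 _ _) _; rewrite ler_wpM2l ?(ltW tau0) //.
have -> : y i - dot (x i) theta - (y i - dot (x i) theta') =
  \sum_(j < d) x i j 0 * (theta' j 0 - theta j 0).
  rewrite (_ : _ - _ = dot (x i) theta' - dot (x i) theta); last by ring.
  by rewrite -sumrB; apply: eq_bigr => j _; rewrite mulrBr.
apply: le_trans (ler_norm_sum _ _ _) _; rewrite mulr_suml ler_sum // => j _.
by rewrite normrM ler_wpM2l // distrC.
Qed.

Lemma rational_approx (theta : 'cV[R]_d) c : 0 < c ->
  exists q : {ffun 'I_d -> rat}, forall j, `|theta j 0 - ratr (q j)| <= c.
Proof.
move=> c0; have /choice[q Hq] : forall j, exists q : rat, `|theta j 0 - ratr q| <= c.
  move=> j; have [|q] := @rat_in_itvoo _ (theta j 0 - c) (theta j 0 + c); first by lra.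
  rewrite in_itv /= => /andP[q1 q2]; exists q.
  by rewrite ler_norml; apply/andP; split; lra.
by exists [ffun j => q j] => j; rewrite ffunE.
Qed.

(** The minimizer itself need not be measurable, but by continuity the minimal
    value is an infimum over the countable set of rational parameters. *)
Lemma measurable_minimal_objective (tau : R) (theta_hat : T -> 'cV[R]_d) :
  0 < tau ->
  (forall w, huber_estimate tau (fun i => vec (Xs i w)) (fun i => Ys i w)
     (theta_hat w)) ->
  measurable_fun setT (fun w => L tau (theta_hat w) w).
Proof.
move=> tau0 min_hat.
pose th (q : {ffun 'I_d -> rat}) : 'cV[R]_d := \col_j ratr (q j).
move=> mD; apply: (measurability _ (RGenInftyO.measurableE R)) => //.
move=> _ [_ [c ->] <-]; rewrite setTI.
have -> : (fun w => L tau (theta_hat w) w) @^-1` `]-oo, c[ =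
    \bigcup_(q in [set: {ffun 'I_d -> rat}]) (L tau (th q) @^-1` `]-oo, c[).
  apply/seteqP; split => w /=; last first.
    by move=> [q _] /=; rewrite !in_itv /=; apply: le_lt_trans; exact: min_hat.
  rewrite in_itv /= => Lc.
  pose A := tau * (\sum_(i < n) \sum_(j < d) `|vec (Xs i w) j 0|).
  have A0 : 0 <= A.
    by rewrite mulr_ge0 ?(ltW tau0) // sumr_ge0 // => i _; rewrite sumr_ge0.
  pose e := (c - L tau (theta_hat w) w) / 2 / (A + 1).
  have e0 : 0 < e by rewrite !divr_gt0 //; lra.
  have [q Hq] := rational_approx (theta_hat w) e0.
  exists q => //=; rewrite in_itv /=.
  have H j : `|th q j 0 - theta_hat w j 0| <= e by rewrite mxE distrC.
  have := huber_objective_lipschitz (fun i => vec (Xs i w)) (fun i => Ys i w) tau0 H.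
  rewrite -/A -/(L tau (th q) w) -/(L tau (theta_hat w) w) => /ler_normlP[_ Hle].
  have eA : A * e <= (c - L tau (theta_hat w) w) / 2.
    by rewrite /e mulrA ler_pdivrMr; lra.
  lra.
apply: countable_bigcupT_measurable => // q.
rewrite -[_ @^-1` _]setTI; apply: measurable_objective => //; exact: measurable_itv.
Qed.

Lemma measurable_score_norm (tau : R) (theta : 'cV[R]_d)
    (X : {RV P >-> d.-tuple (measurableTypeR R)}) : 0 < tau ->
  measurable_fun setT (fun w => score_norm tau
    (fun i => residual (Xs i) (Ys i) theta w) (fun i => whiten X (Xs i w))).
Proof.
move=> tau0; apply: (measurableT_comp (continuous_measurable_fun _)).
  exact: sqrt_continuous.
apply: measurable_sum => j.
have mj : measurable_fun setT (fun w => ((Num.sqrt n%:R)^-1 *: \sum_(i < n)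
    derive1 (huber tau) (residual (Xs i) (Ys i) theta w) *: whiten X (Xs i w)) j 0).
  have -> : (fun w => ((Num.sqrt n%:R)^-1 *: \sum_(i < n)
     derive1 (huber tau) (residual (Xs i) (Ys i) theta w) *: whiten X (Xs i w)) j 0) =
    (fun w => (Num.sqrt n%:R)^-1 * \sum_(i < n)
     huber_score tau (residual (Xs i) (Ys i) theta w) *
     dot (delta_mx j 0) (whiten X (Xs i w))).
    apply/funext => w; rewrite mxE summxE; congr (_ * _); apply: eq_bigr => i _.
    rewrite mxE derive1_huber //; congr (_ * _).
    by rewrite dotE trmx_delta -rowE [RHS]mxE.
  apply: measurable_funM => //; apply: measurable_sum => i; apply: measurable_funM.
    apply: (measurableT_comp (measurable_huber_score tau)).
    exact: measurable_residual.
  exact: (measurableT_comp (measurable_dot_vec _ _) (measurable_funPT (Xs i))).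
exact: measurable_funM.
Qed.

End Measurability.

(** * From the net to the ball *)

Section Uniform.
Context {R : realType} {n d : nat} (z : 'I_n -> 'cV[R]_d).
Hypothesis d_gt0 : (0 < d)%N.

Let gram_err : 'M[R]_d := \sum_(i < n) z i *m (z i)^T - n%:R%:M.

Lemma dot_gram_err u : dot u (gram_err *m u) =
  \sum_(i < n) dot (z i) u ^+ 2 - n%:R * l2norm u ^+ 2.
Proof.
rewrite mulmxBl dotBr mul_scalar_mx dotZr sqr_l2norm; congr (_ - _).
rewrite mulmx_suml dot_sumr; apply: eq_bigr => i _.
rewrite -mulmxA [(z i)^T *m u]mx11_scalar -dotE mul_mx_scalar dotZr.
by rewrite (dotC u) expr2.
Qed.

Lemma gram_net B :
  (forall p, lattice p -> l2norm p <= 2 ->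
     `|\sum_(i < n) dot (z i) p ^+ 2 - n%:R * l2norm p ^+ 2| <= B) ->
  forall u, `|\sum_(i < n) dot (z i) u ^+ 2 - n%:R * l2norm u ^+ 2|
    <= 2 * B * l2norm u ^+ 2.
Proof.
move=> net u; rewrite -dot_gram_err; apply: quadratic_net_abs => //.
  rewrite linearB /= tr_scalar_mx linear_sum /=; congr (_ - _).
  by apply: eq_bigr => i _; rewrite trmx_mul trmxK.
by move=> p lp p2; rewrite dot_gram_err; apply: net.
Qed.

Lemma defect_midpoint big (M x y : R) : 0 < M ->
  defect big M (2^-1 * (x + y)) <= 2^-1 * (defect big M x + defect big M y).
Proof.
move=> M0; rewrite /defect; set m := if big then 0 else M.
set a := Num.max 0 (2 * `|x| - m); set b := Num.max 0 (2 * `|y| - m).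
have a0 : 0 <= a by rewrite /a le_max lexx.
have b0 : 0 <= b by rewrite /b le_max lexx.
have xa : 2 * `|x| - m <= a by rewrite /a le_max lexx orbT.
have yb : 2 * `|y| - m <= b by rewrite /b le_max lexx orbT.
set c := Num.max 0 _; have c0 : 0 <= c by rewrite /c le_max lexx.
have cab : c <= 2^-1 * (a + b).
  rewrite /c ge_max; apply/andP; split; first by lra.
  rewrite normrM (gtr0_norm (_ : 0 < 2^-1 :> R)) //.
  have := ler_normD x y; lra.
have H : c ^+ 2 <= (2^-1 * (a + b)) ^+ 2 by rewrite lerXn2r ?nnegrE //; lra.
apply: le_trans H _; have := sqr_ge0 (a - b); nra.
Qed.

Lemma defect_net (big : 'I_n -> bool) M B : 0 < M ->
  (forall p, lattice p -> l2norm p <= 2 ->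
     \sum_(i < n) defect (big i) M (dot (z i) p) <= B) ->
  forall u, l2norm u <= 1 ->
     \sum_(i < n) defect (big i) M (dot (z i) u) <= B.
Proof.
move=> M0 net.
apply: (midpoint_convex_net d_gt0
  (Phi := fun u => \sum_(i < n) defect (big i) M (dot (z i) u))
  (D := \sum_(i < n) 4 * l2norm (z i) ^+ 2)).
- move=> x y; rewrite -big_split /= mulr_sumr ler_sum // => i _.
  by rewrite dotZr dotDr defect_midpoint.
- move=> u u1; rewrite ler_sum // => i _.
  have [H _] := defectP (big i) (dot (z i) u) M0.
  apply: le_trans H _; rewrite ler_pM2l //.
  have u0 := l2norm_ge0 u; have z0 := l2norm_ge0 (z i).
  have H1 := cauchy_schwarz (z i) u; have H2 := cauchy_schwarz (- z i) u.
  rewrite dotNl l2normN in H2.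
  have : l2norm (z i) * l2norm u <= l2norm (z i) by rewrite ler_piMr.
  nra.
- by move=> p lp p1; have [] := lattice_scale2 lp p1; apply: net.
Qed.

End Uniform.

(** * Probability of the regular event *)

Section NetChernoff.
Context {R : realType} {dT dS : measure_display} {T : measurableType dT}
  {S : measurableType dS} (P : probability T R).

(** The exponent 20 (d + t) pays for the 2 ^ (18 d) points of the net. *)
Lemma net_chernoff (I : eqType) (s : seq I) n d (t c : R) (V : 'I_n -> T -> S)
    (W : T -> S) (f : I -> S -> R) :
  (0 < n)%N -> (0 < d)%N -> 0 < t -> (size s <= 2 ^ (18 * d))%N ->
  (forall i, measurable_fun setT (V i)) -> measurable_fun setT W ->
  iid_copies P V W ->
  (forall p, p \in s -> measurable_fun setT (f p)) ->
  (forall p, p \in s ->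
     (\int[P]_x (expR (f p (W x)))%:E <= (expR (c * ((d%:R + t) / n%:R)))%:E)%E) ->
  let bad := [set x | exists2 p, p \in s &
     (c + 20) * (d%:R + t) <= \sum_(i < n) f p (V i x)] in
  measurable bad /\ (P bad <= (expR (- t) / 2)%:E)%E.
Proof.
move=> n0 d0 t0 size_s mV mW iid mf hf.
have [mB PB] := iid_chernoff_union ((c + 20) * (d%:R + t)) mV mW iid mf hf.
split=> //; apply: le_trans PB _; rewrite lee_fin.
have N0 : (n%:R : R) != 0 by rewrite pnatr_eq0 -lt0n.
have -> : n%:R * (c * ((d%:R + t) / n%:R)) - (c + 20) * (d%:R + t) =
  - (20 * (d%:R + t)) by field.
have e2 : 2 <= expR 1 :> R by have := expR_ge1Dx (1 : R); lra.
have sz : (size s)%:R <= expR (18 * d%:R) :> R.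
  apply: (@le_trans _ _ (2 ^+ (18 * d))).
    by rewrite -natrX ler_nat.
  have -> : expR (18 * d%:R) = expR 1 ^+ (18 * d) :> R.
    by rewrite -expRM_natl natrM mulr1.
  by rewrite lerXn2r ?nnegrE ?expR_ge0.
apply: (@le_trans _ _ (expR (18 * d%:R) * expR (- (20 * (d%:R + t))))).
  by rewrite ler_wpM2r ?expR_ge0.
rewrite -expRD; apply: (@le_trans _ _ (expR (- t - 1))).
  rewrite ler_expR; have : 1 <= d%:R :> R by rewrite ler1n.
  lra.
by rewrite expRD ler_pM2l ?expR_gt0 // expRN lef_pV2 ?posrE ?expR_gt0.
Qed.

End NetChernoff.

Section Noise.
Context {R : realType} {dT : measure_display} {T : measurableType dT}
  (P : probability T R) {d : nat}.
Context (X : {RV P >-> d.-tuple (measurableTypeR R)}) (Y : {RV P >-> R}).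
Context (theta : 'cV[R]_d) (sigma delta : R).

(** A negative ups satisfies ups `^ r = 1, so that nothing relates it to v; it is
    replaced by its positive part. *)
Lemma noise_moments_max ups : noise_moments X Y theta sigma delta ups ->
  noise_moments X Y theta sigma delta (Num.max 0 ups).
Proof.
move=> [H1 H2 [g [H3 H4]]]; split => //; exists g; split => //.
by apply: filterS H4 => w gw; rewrite le_max gw orbT.
Qed.

(** Instead of Jensen's inequality, integrate
    e^2 <= v^2 + v^(- delta) |e|^(2 + delta). *)
Lemma noise_variance_le ups v : 0 <= delta -> 0 < v -> 0 <= ups ->
  ups <= v `^ (2 + delta) ->
  noise_moments X Y theta sigma delta ups -> sigma ^+ 2 <= 2 * v ^+ 2.
Proof.
move=> d0 v0 u0 uv [_ c2 [g [cg gu]]].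
set eps := residual X Y theta in c2 cg.
have mX : measurable_fun setT X := measurable_funPT X.
have meps : measurable_fun setT eps := measurable_residual X Y theta.
have E2 : (\int[P]_w (eps w ^+ 2)%:E = (sigma ^+ 2)%:E)%E.
  have := cond_expectation_integral c2 measurableT.
  rewrite (eq_integral (fun w => (eps w ^+ 2)%:E)); last first.
    by move=> w _; rewrite indicT mulr1.
  move=> ->; rewrite (eq_integral (fun=> (sigma ^+ 2)%:E)); last first.
    by move=> w _; rewrite indicT mulr1.
  by rewrite integral_cst // -[RHS]mule1; congr (_ * _)%E; exact: probability_setT.
have Ed : (\int[P]_w (`|eps w| `^ (2 + delta))%:E <= ups%:E)%E.
  have := cond_expectation_le cg mX (fun w => powR_ge0 _ _) u0 gu
    (@measurable_cst _ _ _ _ setT (1 : R)) (fun=> ler01).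
  rewrite (eq_integral (fun w => (`|eps w| `^ (2 + delta))%:E)); last first.
    by move=> w _; rewrite mulr1.
  move=> H; apply: le_trans H _.
  rewrite (eq_integral (fun=> 1%:E)) // integral_cst // mul1e.
  rewrite -[leRHS]mule1 lee_wpmul2l ?lee_fin //.
  exact: probability_le1.
have mea : measurable_fun setT (fun w => `|eps w| `^ (2 + delta)).
  apply: (measurableT_comp (measurable_powR (2 + delta))); exact: measurableT_comp.
have vd0 : 0 <= v `^ (- delta) by exact: powR_ge0.
rewrite -lee_fin -E2.
apply: (@le_trans _ _ (\int[P]_w ((v ^+ 2)%:E + (v `^ (- delta))%:E *
    (`|eps w| `^ (2 + delta))%:E))%E).
  apply: ge0_le_integral => //.
  - by move=> w _; rewrite lee_fin sqr_ge0.
  - by apply/measurable_EFinP; exact: measurable_funX.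
  - apply: emeasurable_funD => //; apply: emeasurable_funM => //.
    exact/measurable_EFinP.
  move=> w _; rewrite -EFinM -EFinD lee_fin.
  rewrite -(real_normK (num_real (eps w))).
  have [ev|ev] := lerP `|eps w| v.
    apply: (@le_trans _ _ (v ^+ 2)).
      by rewrite lerXn2r ?nnegrE ?(ltW v0).
    by rewrite lerDl mulr_ge0 ?powR_ge0.
  have e0 : 0 < `|eps w| by lra.
  rewrite powRD; last by rewrite (gt_eqF e0) implybT.
  rewrite -[in `|eps w| `^ 2]/(2%:R) powR_mulrn //.
  have : 1 <= v `^ (- delta) * `|eps w| `^ delta.
    rewrite powRN mulrC ler_pdivlMr ?powR_gt0 // mul1r.
    by rewrite ge0_ler_powR ?nnegrE //; lra.
  move=> H; have := ler_wpM2r (sqr_ge0 `|eps w|) H; have := sqr_ge0 v; lra.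
rewrite ge0_integralD //; last 3 first.
- by move=> w _; rewrite lee_fin sqr_ge0.
- by move=> w _; rewrite -EFinM lee_fin mulr_ge0 ?powR_ge0.
- by apply: emeasurable_funM => //; exact/measurable_EFinP.
rewrite integral_cst // ge0_integralZl_EFin //; last exact/measurable_EFinP.
have P1 : (P [set: T] <= 1)%E by exact: probability_le1.
apply: (@le_trans _ _ ((v ^+ 2)%:E * 1 + (v `^ (- delta))%:E * ups%:E)%E).
  by apply: leeD; rewrite lee_wpmul2l ?lee_fin ?sqr_ge0.
rewrite mule1 -EFinM -EFinD lee_fin.
have : v `^ (- delta) * ups <= v `^ (- delta) * v `^ (2 + delta) by rewrite ler_wpM2l.
rewrite -powRD; last by rewrite (gt_eqF v0) implybT.
have -> : - delta + (2 + delta) = 2%:R by ring.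
rewrite powR_mulrn ?(ltW v0) //; lra.
Qed.

End Noise.

Section Truncation.
Context {R : realType}.

(** Everything follows from tau^(2 + delta) = v^(2 + delta) / rho and
    sqrt rho <= rho^(1 / (2 + delta)) <= 1. *)
Lemma truncation_level_bounds (v delta rho ups sigma : R)
    (tau := v * rho^-1 `^ (2 + delta)^-1)
    (lam := Num.sqrt rho / v) :
  0 < v -> 0 <= delta -> 0 < rho <= 1 -> 0 <= ups -> ups <= v `^ (2 + delta) ->
  sigma ^+ 2 <= 2 * v ^+ 2 ->
  [/\ v <= tau, lam * tau <= 1, lam ^+ 2 * sigma ^+ 2 <= 2 * rho,
      lam * tau `^ (- (1 + delta)) * ups <= rho &
      ups * (tau / 2) `^ (- (2 + delta)) <= 2 `^ (2 + delta) * rho].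
Proof.
move=> v0 d0 /andP[r0 r1] u0 uv sv.
have ri1 : 1 <= rho^-1 by rewrite invf_ge1.
have g1 : 1 <= rho^-1 `^ (2 + delta)^-1.
  apply: (@le_trans _ _ (rho^-1 `^ 0)); first by rewrite powRr0.
  by rewrite ler_powR // invr_ge0; lra.
have q0 : 0 < Num.sqrt rho by rewrite sqrtr_gt0.
have vtau : v <= tau by rewrite ler_peMr // ltW.
have tau0 : 0 < tau by lra.
have lamtau : lam * tau <= 1.
  rewrite /lam /tau mulrA divfK ?gt_eqF //.
  have E : Num.sqrt rho * rho^-1 `^ 2^-1 = 1.
    by rewrite powR12_sqrt ?invr_ge0 ?(ltW r0) // sqrtrV ?(ltW r0) // mulfV ?gt_eqF.
  rewrite -[leRHS]E ler_pM2l // ler_powR // lef_pV2 ?posrE; lra.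
have tau2 : tau `^ (2 + delta) = v `^ (2 + delta) / rho.
  have d20 : 0 < 2 + delta by lra.
  rewrite /tau powRM ?(ltW v0) ?powR_ge0 // -powRrM mulVf ?(gt_eqF d20) //.
  by rewrite powRr1 // invr_ge0 ltW.
have key : tau `^ (- (2 + delta)) * ups <= rho.
  rewrite powRN tau2 invf_div mulrAC ler_pdivrMr ?powR_gt0 //.
  by rewrite ler_pM2l.
have key0 : 0 <= tau `^ (- (2 + delta)) * ups by rewrite mulr_ge0 ?powR_ge0.
split => //.
- rewrite /lam expr_div_n sqr_sqrtr ?(ltW r0) // mulrAC ler_pdivrMr ?exprn_gt0 //.
  have := ler_wpM2l (ltW r0) sv; lra.
- have -> : - (1 + delta) = 1 + - (2 + delta) by ring.
  rewrite powRD; last by rewrite (gt_eqF tau0) implybT.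
  rewrite powRr1 ?(ltW tau0) // mulrA -mulrA; apply: le_trans key.
  by rewrite ler_piMl.
have -> : (tau / 2) `^ (- (2 + delta)) = tau `^ (- (2 + delta)) * 2 `^ (2 + delta).
  rewrite powRM ?(ltW tau0) ?invr_ge0 //; congr (_ * _).
  have -> : 2^-1 = 2 `^ (- 1) :> R by rewrite powR_inv1.
  by rewrite -powRrM mulrNN mul1r.
by rewrite mulrA [ups * _]mulrC [leRHS]mulrC ler_wpM2r ?powR_ge0.
Qed.


End Truncation.

Section RegularEvent.
Context {R : realType} {dT : measure_display} {T : measurableType dT}
  (P : probability T R) (n d : nat).
Context (X : {RV P >-> d.-tuple (measurableTypeR R)}) (Y : {RV P >-> R})
  (Xs : 'I_n -> {RV P >-> d.-tuple (measurableTypeR R)})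
  (Ys : 'I_n -> {RV P >-> R}).
Context (theta : 'cV[R]_d) (sigma delta ups A0 t v : R).

Let rho := (d%:R + t) / n%:R.
Let q := Num.sqrt rho.
Let tau := v * rho^-1 `^ (2 + delta)^-1.
Let eps w i := residual (Xs i) (Ys i) theta w.
Let z w i := whiten X (Xs i w).

(** These constants are read off from net_chernoff: score_const is the C1 of the
    bound C1 v n q on the score, gram_const and defect_const are the factors of
    n q in the other two bounds. *)
Definition score_const (a : R) : R := score_mgf_const a + 20.

Definition gram_const (a : R) : R := 32 * a ^+ 2 * (quad_mgf_const a + 20).

Definition defect_const (a del : R) : R :=
  64 * a ^+ 2 * ((2 `^ (2 + del) + 64 * a ^+ 2 * (64 * score_const a ^+ 2))
    * @gauss_moment R + 20).

Lemma score_const_gt0 a : 0 < score_const a.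
Proof.
have K1 := gauss_moment_ge1 R; rewrite ltr_wpDl // mulr_ge0 //; last by lra.
have s0 : 0 <= ((8 * a ^+ 2)^-1)^-1 by rewrite invrK mulr_ge0 ?sqr_ge0.
rewrite addr_ge0 ?addr_ge0 // mulr_ge0 ?expR_ge0 // mulr_ge0 //.
Qed.

(** Four applications of net_chernoff, two of them for the two signs of the Gram
    error.  The threshold of the defect is tau / (2 r) for the radius
    r = 4 C1 v q on which the expansion is needed. *)
Lemma regular_event :
  (0 < n)%N -> (0 < d)%N -> 0 < t -> 0 < A0 -> 0 <= delta -> 0 < v -> 0 <= ups ->
  ups <= v `^ (2 + delta) -> rho <= 1 ->
  iid_copies P (fun i w => (Ys i w, Xs i w)) (fun w => (Y w, X w)) ->
  subgaussian_design X A0 -> noise_moments X Y theta sigma delta ups ->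
  exists2 bad : set T, measurable bad /\ (P bad <= (3 * expR (- t))%:E)%E &
  forall w, ~ bad w ->
  [/\ l2norm (score_sum tau (eps w) (z w)) <= score_const A0 * v * n%:R * q,
      forall u, `|\sum_(i < n) dot (z w i) u ^+ 2 - n%:R * l2norm u ^+ 2|
         <= gram_const A0 * n%:R * q * l2norm u ^+ 2 &
      forall u, l2norm u <= 1 ->
        \sum_(i < n) defect (tau / 2 < `|eps w i|)
          (tau / (8 * score_const A0 * v * q)) (dot (z w i) u)
         <= defect_const A0 delta * n%:R * q].
Proof.
move=> n0 d0 t0 A00 del0 v0 u0 uv rho1 iid subg noise.
have N0 : (0 : R) < n%:R by rewrite ltr0n.
have D0 : (0 : R) < d%:R by rewrite ltr0n.
have rho0 : 0 < rho by rewrite divr_gt0 //; lra.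
have q0 : 0 < q by rewrite sqrtr_gt0.
have qq : q ^+ 2 = rho by rewrite sqr_sqrtr // ltW.
have q1 : q <= 1 by rewrite -sqrtr1 ler_wsqrtr.
have dtE : d%:R + t = q ^+ 2 * n%:R by rewrite qq divfK ?gt_eqF.
have sv := noise_variance_le del0 v0 u0 uv noise.
have [|vtau lamtau lamsig lamups upsrho] :=
  truncation_level_bounds v0 del0 _ u0 uv sv (rho := rho); first by rewrite rho0.
rewrite -/tau -/q in vtau lamtau lamsig lamups upsrho.
have tau0 : 0 < tau by lra.
have lam0 : 0 < q / v by rewrite divr_gt0.
have [net [size_net net2 netP]] := @lattice_net R d d0.
pose V (i : 'I_n) (w : T) := (Ys i w : R, Xs i w : d.-tuple (measurableTypeR R)).
pose W (w : T) := (Y w : R, X w : d.-tuple (measurableTypeR R)).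
have mV i : measurable_fun setT (V i).
  by apply: measurable_fun_pair; exact: measurable_funPT.
have mW : measurable_fun setT W.
  by apply: measurable_fun_pair; exact: measurable_funPT.
pose res (yx : R * d.-tuple (measurableTypeR R)) := yx.1 - dot (vec yx.2) theta.
pose wh p (yx : R * d.-tuple (measurableTypeR R)) := dot p (whiten X yx.2).
have mwh p : measurable_fun setT (wh p).
  exact: (measurableT_comp (measurable_dot_vec p _) measurable_snd).
have mres : measurable_fun setT res.
  apply: measurable_funB => //.
  have -> : (fun yx : R * d.-tuple (measurableTypeR R) => dot (vec yx.2) theta) =
      (fun x : d.-tuple (measurableTypeR R) => dot theta (1%:M *m vec x)) \o snd.
    by apply/funext => yx /=; rewrite mul1mx dotC.
  exact: (measurableT_comp (measurable_dot_vec theta _) measurable_snd).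
pose s := (8 * A0 ^+ 2)^-1.
have s0 : 0 < s by rewrite invr_gt0 mulr_gt0 // exprn_gt0.
have C10 := score_const_gt0 A0.
pose M := tau / (8 * score_const A0 * v * q).
have M0 : 0 < M by rewrite divr_gt0 // !mulr_gt0.
pose f1 p yx := q / v * (huber_score tau (res yx) * wh p yx).
pose f2 a p yx := a * (s / 2 * q) * (wh p yx ^+ 2 - dot p p).
pose f3 p yx := s / 8 * defect (tau / 2 < `|res yx|) M (wh p yx).
have mf1 p : measurable_fun setT (f1 p).
  apply: measurable_funM => //; apply: measurable_funM => //.
  exact: (measurableT_comp (measurable_huber_score tau)).
have mf2 a p : measurable_fun setT (f2 a p).
  apply: measurable_funM => //; apply: measurable_funB => //.
  exact: measurable_funX.
have mf3 p : measurable_fun setT (f3 p).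
  by apply: measurable_funM => //; exact: measurable_defect.
have qrho : 0 <= q <= 1 by rewrite (ltW q0).
have h1 p : p \in net ->
    (\int[P]_x (expR (f1 p (W x)))%:E <= (expR (score_mgf_const A0 * rho))%:E)%E.
  by move=> /net2 p2; exact: (score_mgf A00 subg noise u0 del0 p2 (ltW lam0) tau0).
have h2 a p : `|a| <= 1 -> p \in net ->
    (\int[P]_x (expR (f2 a p (W x)))%:E <= (expR (quad_mgf_const A0 * rho))%:E)%E.
  move=> a1 /net2 p2; rewrite -qq.
  exact: (quad_mgf A00 subg p2 a1 qrho).
pose k := 64 * score_const A0 ^+ 2.
have kM : M ^- 2 <= k * rho.
  have -> : M ^- 2 = k * rho * (v / tau) ^+ 2.
    by rewrite /M /k -qq; field; rewrite ?gt_eqF.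
  have kr0 : 0 <= k * rho by rewrite mulr_ge0 ?(ltW rho0) // mulr_ge0 ?sqr_ge0.
  rewrite ler_piMr //.
  apply: exprn_ile1; first by rewrite divr_ge0 ?(ltW v0) ?(ltW tau0).
  by rewrite ler_pdivrMr // mul1r.
pose Cd := (2 `^ (2 + delta) + 8 / s * k) * @gauss_moment R.
have h3 p : p \in net ->
    (\int[P]_x (expR (f3 p (W x)))%:E <= (expR (Cd * rho))%:E)%E.
  move=> /net2 p2.
  exact: (defect_mgf A00 subg noise u0 del0 p2 M0 tau0 (ltW rho0) upsrho kM).
have a1 : `|1 : R| <= 1 by rewrite normr1.
have aN1 : `|-1 : R| <= 1 by rewrite normrN1.
have [mb1 Pb1] := net_chernoff n0 d0 t0 size_net mV mW iid (fun p _ => mf1 p) h1.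
have [mb2 Pb2] := net_chernoff n0 d0 t0 size_net mV mW iid
  (fun p _ => mf2 1 p) (fun p => h2 1 p a1).
have [mb3 Pb3] := net_chernoff n0 d0 t0 size_net mV mW iid
  (fun p _ => mf2 (-1) p) (fun p => h2 (-1) p aN1).
have [mb4 Pb4] := net_chernoff n0 d0 t0 size_net mV mW iid (fun p _ => mf3 p) h3.
set b1 := [set x | _] in mb1 Pb1; set b2 := [set x | _] in mb2 Pb2.
set b3 := [set x | _] in mb3 Pb3; set b4 := [set x | _] in mb4 Pb4.
exists ((b1 `|` b2) `|` (b3 `|` b4)).
  split; first by apply: measurableU; apply: measurableU.
  apply: (@le_trans _ _ (expR (- t) / 2 + expR (- t) / 2 +
    (expR (- t) / 2 + expR (- t) / 2))%:E).
    rewrite EFinD; apply: le_trans (measureU2 _ _ _) _;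
      [exact: measurableU|exact: measurableU|].
    by apply: leeD; rewrite EFinD; (apply: le_trans (measureU2 _ _ _) _ => //);
      apply: leeD.
  by rewrite lee_fin; have := expR_ge0 (- t); lra.
move=> w /not_orP[/not_orP[nb1 nb2] /not_orP[nb3 nb4]].
have lt1 p : p \in net ->
    \sum_(i < n) f1 p (V i w) < (score_mgf_const A0 + 20) * (d%:R + t).
  by move=> pn; rewrite ltNge; apply/negP => H; apply: nb1; exists p.
have lt2 p : p \in net ->
    \sum_(i < n) f2 1 p (V i w) < (quad_mgf_const A0 + 20) * (d%:R + t).
  by move=> pn; rewrite ltNge; apply/negP => H; apply: nb2; exists p.
have lt3 p : p \in net ->
    \sum_(i < n) f2 (-1) p (V i w) < (quad_mgf_const A0 + 20) * (d%:R + t).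
  by move=> pn; rewrite ltNge; apply/negP => H; apply: nb3; exists p.
have lt4 p : p \in net -> \sum_(i < n) f3 p (V i w) < (Cd + 20) * (d%:R + t).
  by move=> pn; rewrite ltNge; apply/negP => H; apply: nb4; exists p.
rewrite dtE in lt1 lt2 lt3 lt4.
split.
- apply: linear_net => // p lp p2; have := lt1 p (netP p lp p2).
  rewrite -mulr_sumr.
  rewrite (_ : \sum_(i < n) _ = dot p (score_sum tau (eps w) (z w))); last first.
    by rewrite dot_score_sum; apply: eq_bigr => i _; rewrite (dotC (z w i)).
  have -> : (score_mgf_const A0 + 20) * (q ^+ 2 * n%:R) =
    q / v * (score_const A0 * v * n%:R * q).
    by rewrite /score_const; field; rewrite gt_eqF.
  by rewrite ltr_pM2l // => /ltW.
- have -> : gram_const A0 * n%:R * q =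
    2 * (16 * A0 ^+ 2 * (quad_mgf_const A0 + 20) * n%:R * q).
    by rewrite /gram_const; ring.
  apply: gram_net => // p lp p2; have pn := netP p lp p2.
  have E a : \sum_(i < n) f2 a p (V i w) =
     a * (s / 2 * q) * (\sum_(i < n) dot (z w i) p ^+ 2 - n%:R * l2norm p ^+ 2).
    rewrite -mulr_sumr sumrB sumr_const card_ord sqr_l2norm.
    congr (_ * (_ - _)); last by rewrite mulr_natl.
    by apply: eq_bigr => i _; rewrite (dotC (z w i)).
  have := lt2 p pn; have := lt3 p pn; rewrite !E; set D := _ - _.
  have -> : (quad_mgf_const A0 + 20) * (q ^+ 2 * n%:R) =
    s / 2 * q * (16 * A0 ^+ 2 * (quad_mgf_const A0 + 20) * n%:R * q).
    by rewrite /s; field; rewrite gt_eqF.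
  have sq0 : 0 < s / 2 * q by rewrite mulr_gt0 // divr_gt0.
  rewrite mulN1r mul1r mulNr -mulrN !ltr_pM2l // => D1 D2.
  by rewrite ler_norml; apply/andP; split; lra.
have C20 : 0 <= Cd + 20.
  have K1 := gauss_moment_ge1 R; rewrite addr_ge0 // mulr_ge0 //; last by lra.
  by rewrite addr_ge0 ?powR_ge0 // mulr_ge0 ?divr_ge0 ?(ltW s0) // mulr_ge0 ?sqr_ge0.
move=> u u1; apply: (@le_trans _ _ (8 / s * (Cd + 20) * (q ^+ 2 * n%:R))); last first.
  have -> : 8 / s * (Cd + 20) = defect_const A0 delta.
    by rewrite /defect_const /Cd /k /s; field; rewrite gt_eqF.
  have cd0 : 0 <= defect_const A0 delta * n%:R.
    have -> : defect_const A0 delta = 8 / s * (Cd + 20).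
      by rewrite /defect_const /Cd /k /s; field; rewrite gt_eqF.
    by rewrite mulr_ge0 // mulr_ge0 // divr_ge0 // ltW.
  rewrite [q ^+ 2 * _]mulrC mulrA ler_wpM2l //.
  by rewrite expr2 ler_piMl // ltW.
move: u u1; apply: defect_net => // p lp p2.
have := lt4 p (netP p lp p2); rewrite -mulr_sumr => /ltW.
have -> : (Cd + 20) * (q ^+ 2 * n%:R) =
  s / 8 * (8 / s * (Cd + 20) * (q ^+ 2 * n%:R)) by field; rewrite gt_eqF.
rewrite ler_pM2l ?divr_gt0 //; apply: le_trans.
rewrite le_eqVlt; apply/orP; left; apply/eqP; apply: eq_bigr => i _.
by rewrite (dotC (z w i)).
Qed.

End RegularEvent.

(** * The expansion of the excess *)

Section Expansion.
Context {R : realType}.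

Lemma gram_const_gt0 (a : R) : 0 < a -> 0 < gram_const a.
Proof.
move=> a0; have K1 := gauss_moment_ge1 R.
rewrite mulr_gt0 // ?mulr_gt0 ?exprn_gt0 // ltr_wpDl //.
by rewrite mulr_ge0 ?mulr_ge0 ?expR_ge0 //; lra.
Qed.

Lemma defect_const_ge0 (a del : R) : 0 <= defect_const a del.
Proof.
have K1 := gauss_moment_ge1 R; have a2 := sqr_ge0 a.
have c2 := sqr_ge0 (score_const a).
have pw : 0 <= 2 `^ (2 + del) by exact: powR_ge0.
have c64 : 0 <= 64 * a ^+ 2 by rewrite mulr_ge0.
have k0 : 0 <= 64 * a ^+ 2 * (64 * score_const a ^+ 2) by rewrite mulr_ge0 // mulr_ge0.
have K0 : 0 <= @gauss_moment R by lra.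
have := mulr_ge0 (addr_ge0 pw k0) K0 => H.
by rewrite /defect_const mulr_ge0 // addr_ge0.
Qed.

Lemma le_powR_of_root (ups v del : R) : 0 <= del -> ups `^ (2 + del)^-1 <= v ->
  Num.max 0 ups <= v `^ (2 + del).
Proof.
move=> d0 uv; have [u0|u0] := lerP ups 0; first exact: powR_ge0.
have d2 : 0 < 2 + del by lra.
have -> : ups = (ups `^ (2 + del)^-1) `^ (2 + del).
  by rewrite -powRrM mulVf ?gt_eqF // powRr1 // ltW.
rewrite ge0_ler_powR ?nnegrE ?powR_ge0 //; first exact: ltW.
by apply: le_trans uv; exact: powR_ge0.
Qed.

Lemma huber0 (u : R) : huber 0 u = 0.
Proof.
rewrite /huber expr0n /= !mul0r subr0; case: ifP => //.
by rewrite normr_le0 => /eqP ->; rewrite expr0n /= mul0r.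
Qed.

Lemma huber_objectiveE n d (tau : R) (x : 'I_n -> 'cV[R]_d) y theta u S :
  S^T = S ->
  huber_objective tau x y (theta + S *m u) =
  \sum_(i < n) huber tau (y i - dot (x i) theta - dot (S *m x i) u).
Proof.
move=> symS; apply: eq_bigr => i _; congr (huber tau _).
by rewrite dotDr dot_mulmx symS opprD addrA.
Qed.

Lemma score_normE n d (tau : R) (eps : 'I_n -> R) (z : 'I_n -> 'cV[R]_d) : 0 < tau ->
  score_norm tau eps z = (Num.sqrt n%:R)^-1 * l2norm (score_sum tau eps z).
Proof.
move=> tau0; rewrite /score_norm l2normZ ger0_norm ?invr_ge0 ?sqrtr_ge0 //.
by congr (_ * l2norm _); apply: eq_bigr => i _; rewrite derive1_huber.
Qed.

(** The risk gain at u is the decrease of the objective from theta to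
    theta + S u, so that the excess is its maximum.  Here q stands for
    sqrt ((d + t) / n) and D for d + t; the radius r = 4 C1 v q turns the assumed
    threshold of the defect into tau / (2 r). *)
Lemma wilks_expansion n d (tau : R) (x : 'I_n -> 'cV[R]_d) y theta theta_hat S
    C1 C2 C3 v D q
    (eps := fun i => y i - dot (x i) theta) (z := fun i => S *m x i)
    (E := huber_objective tau x y theta - huber_objective tau x y theta_hat)
    (xi := score_norm tau eps z) :
  (0 < n)%N -> 0 < tau -> 0 < C1 -> 0 < C2 -> 0 <= C3 -> 0 < v -> 0 < q ->
  D = q ^+ 2 * n%:R -> 2 * (C2 + C3) * q <= 1 -> S^T = S -> S \in unitmx ->
  huber_estimate tau x y theta_hat ->
  l2norm (score_sum tau eps z) <= C1 * v * n%:R * q ->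
  (forall u, `|\sum_(i < n) dot (z i) u ^+ 2 - n%:R * l2norm u ^+ 2|
         <= C2 * n%:R * q * l2norm u ^+ 2) ->
  (forall u, l2norm u <= 1 ->
        \sum_(i < n) defect (tau / 2 < `|eps i|) (tau / (8 * C1 * v * q)) (dot (z i) u)
         <= C3 * n%:R * q) ->
  `|E - 2^-1 * xi ^+ 2| <= (C2 + C3) * C1 ^+ 2 * v ^+ 2 * (q * D) /\
  `|Num.sqrt (2 * E) - xi| <= 2 * (C2 + C3) * C1 * v * (q * Num.sqrt D).
Proof.
move=> n0 tau0 C10 C20 C30 v0 q0 DE Cq symS Su min_hat Hs Hq Hd.
have N0 : (0 : R) < n%:R by rewrite ltr0n.
pose sn := Num.sqrt (n%:R : R).
have sn0 : 0 < sn by rewrite sqrtr_gt0.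
have snn : sn ^+ 2 = n%:R by rewrite sqr_sqrtr // ltW.
pose wh := invmx S *m (theta_hat - theta).
have obj u : huber_objective tau x y theta - huber_objective tau x y (theta + S *m u) =
    risk_gain tau eps z u.
  by rewrite (huber_objectiveE _ _ _ _ _ symS) -sumrB.
have hatE : theta_hat = theta + S *m wh by rewrite mulKVmx // addrC subrK.
have EE : E = risk_gain tau eps z wh by rewrite /E {1}hatE obj.
have Emax u : risk_gain tau eps z u <= E.
  by rewrite -obj /E lerD2l lerN2; exact: min_hat.
have c8 : 0 < 8 * C1 * v * q by rewrite !mulr_gt0.
have M0 : 0 < tau / (8 * C1 * v * q) by rewrite divr_gt0.
have r0 : 0 < 4 * C1 * v * q by rewrite !mulr_gt0.
have rM : 2 * (4 * C1 * v * q) * (tau / (8 * C1 * v * q)) <= tau.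
  rewrite le_eqVlt; apply/orP; left; apply/eqP; field.
  by rewrite !gt_eqF.
have B1r : 4 * (C1 * v * n%:R * q) <= n%:R * (4 * C1 * v * q) by lra.
have B20 : 0 <= C2 * n%:R * q by rewrite !mulr_ge0 // ltW.
have B30 : 0 <= C3 * n%:R * q by rewrite !mulr_ge0 // ltW.
have Bn : 2 * (C2 * n%:R * q + C3 * n%:R * q) <= n%:R.
  have := ler_wpM2r (ltW N0) Cq; lra.
have [] := excess_sandwich n0 tau0 M0 r0 rM Hs B1r Hq Hd B20 B30 Bn EE Emax.
have -> : (C2 * n%:R * q + C3 * n%:R * q) / n%:R = (C2 + C3) * q.
  by field; rewrite gt_eqF.
have xiE : xi = sn^-1 * l2norm (score_sum tau eps z) by rewrite /xi score_normE.
have -> : l2norm (score_sum tau eps z) ^+ 2 / n%:R = xi ^+ 2.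
  by rewrite xiE -snn; field; rewrite gt_eqF.
have xi0 : 0 <= xi by rewrite xiE mulr_ge0 ?l2norm_ge0 // invr_ge0 ltW.
have kap : 0 <= (C2 + C3) * q <= 2^-1.
  apply/andP; split; last by lra.
  by rewrite mulr_ge0 ?addr_ge0 // ltW.
have sD : Num.sqrt D = q * sn.
  by rewrite DE sqrtrM ?sqr_ge0 // sqrtr_sqr gtr0_norm.
have xiB : xi <= C1 * v * Num.sqrt D.
  rewrite xiE ler_pdivrMl // sD; apply: le_trans Hs _.
  by rewrite -snn le_eqVlt; apply/orP; left; apply/eqP; ring.
have sD0 : 0 <= Num.sqrt D := sqrtr_ge0 D.
have D0 : 0 <= D by rewrite DE mulr_ge0 ?sqr_ge0 // ltW.
move=> H1 H2; have [K1 K2] := excess_estimates kap xi0 H1 H2.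
have CC0 : 0 <= (C2 + C3) * q by case/andP: kap.
split.
  apply: le_trans K1 _.
  have -> : (C2 + C3) * C1 ^+ 2 * v ^+ 2 * (q * D) =
      (C2 + C3) * q * (C1 * v * Num.sqrt D) ^+ 2.
    by rewrite exprMn sqr_sqrtr //; ring.
  by rewrite ler_wpM2l // lerXn2r ?nnegrE // !mulr_ge0 // ltW.
apply: le_trans K2 _.
have -> : 2 * (C2 + C3) * C1 * v * (q * Num.sqrt D) =
    2 * ((C2 + C3) * q) * (C1 * v * Num.sqrt D) by ring.
by rewrite ler_wpM2l // mulr_ge0.
Qed.

End Expansion.

Theorem theorem2p2 (R : realType) (A0 delta : R) (A0_gt0 : 0 < A0)
    (delta_ge0 : 0 <= delta) :
  exists c3 c4 c5 : R, [/\ 0 < c3, 0 < c4, 0 < c5 &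
  forall (dT : measure_display) (T : measurableType dT) (P : probability T R)
    (n d : nat)
    (X : {RV P >-> d.-tuple (measurableTypeR R)}) (Y : {RV P >-> R})
    (Xs : 'I_n -> {RV P >-> d.-tuple (measurableTypeR R)})
    (Ys : 'I_n -> {RV P >-> R})
    (theta_star : 'cV[R]_d) (sigma ups t v : R) (theta_hat : T -> 'cV[R]_d),
  iid_copies P (fun i w => (Ys i w, Xs i w)) (fun w => (Y w, X w)) ->
  subgaussian_design X A0 ->
  noise_moments X Y theta_star sigma delta ups ->
  0 < t ->
  ups `^ (2 + delta)^-1 <= v ->
  let tau := v * (n%:R / (d%:R + t)) `^ (2 + delta)^-1 in
  let x w i := vec (Xs i w) in
  let y w i := Ys i w in
  (forall w, huber_estimate tau (x w) (y w) (theta_hat w)) ->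
  c3 * (d%:R + t) <= n%:R ->
  let excess w := huber_objective tau (x w) (y w) theta_star
                  - huber_objective tau (x w) (y w) (theta_hat w) in
  let xi w := score_norm tau (fun i => residual (Xs i) (Ys i) theta_star w)
                             (fun i => whiten X (Xs i w)) in
  let good := [set w |
    `|excess w - 2^-1 * xi w ^+ 2|
      <= c4 * v ^+ 2 * ((d%:R + t) `^ (3 / 2) / Num.sqrt n%:R) /\
    `|Num.sqrt (2 * excess w) - xi w| <= c5 * v * ((d%:R + t) / Num.sqrt n%:R)] in
  ((1 - 3 * expR (- t))%:E <= P good)%E].
Proof.
pose C1 := score_const A0; pose C2 := gram_const A0.
pose C3 := defect_const A0 delta.
have C10 : 0 < C1 by exact: score_const_gt0.
have C20 : 0 < C2 by exact: gram_const_gt0.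
have C30 : 0 <= C3 by exact: defect_const_ge0.
pose C := C2 + C3; have C0 : 0 < C by rewrite ltr_wpDr.
exists (1 + 4 * C ^+ 2), (C * C1 ^+ 2), (2 * C * C1); split.
- by rewrite ltr_wpDr // mulr_ge0 ?sqr_ge0.
- by rewrite mulr_gt0 ?exprn_gt0.
- by rewrite !mulr_gt0.
move=> dT T P n d X Y Xs Ys theta_star sigma ups t v theta_hat iid subg noise
  t0 upsv tau x y min_hat nbig.
pose excess w := huber_objective tau (x w) (y w) theta_star
                 - huber_objective tau (x w) (y w) (theta_hat w).
pose xi w := score_norm tau (fun i => residual (Xs i) (Ys i) theta_star w)
                            (fun i => whiten X (Xs i w)).
pose good := [set w | `|excess w - 2^-1 * xi w ^+ 2|
      <= C * C1 ^+ 2 * v ^+ 2 * ((d%:R + t) `^ (3 / 2) / Num.sqrt n%:R) /\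
    `|Num.sqrt (2 * excess w) - xi w|
      <= 2 * C * C1 * v * ((d%:R + t) / Num.sqrt n%:R)].
have D0 : 0 < d%:R + t by rewrite ltr_wpDl.
have c30 : 1 <= 1 + 4 * C ^+ 2 by rewrite lerDl mulr_ge0 ?sqr_ge0.
have nD : d%:R + t <= n%:R by apply: le_trans nbig; rewrite ler_peMl // ltW.
have N0 : (0 : R) < n%:R by lra.
have n0 : (0 < n)%N by rewrite -(ltr0n R).
have v_ge0 : 0 <= v by apply: le_trans upsv; exact: powR_ge0.
(* d = 0 and v = 0 are degenerate: the lattice net needs d > 0, and v = 0 makes
   tau = 0, for which the loss vanishes identically *)
have trivial_good : (forall w, good w) ->
    ((1 - 3 * expR (- t))%:E <= P good)%E.
  move=> H; have -> : good = [set: T] by apply/seteqP; split.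
  rewrite (_ : P [set: T] = 1%E); last exact: probability_setT.
  by rewrite lee_fin; have := expR_ge0 (- t); lra.
have zero_good : (forall w, excess w = 0) -> (forall w, xi w = 0) ->
    ((1 - 3 * expR (- t))%:E <= P good)%E.
  move=> E0 xi0; apply: trivial_good => w; rewrite /good /= E0 xi0.
  rewrite expr0n /= !mulr0 subr0 normr0 sqrtr0 subr0 normr0; split.
    rewrite mulr_ge0 ?divr_ge0 ?powR_ge0 ?sqrtr_ge0 // mulr_ge0 ?sqr_ge0 //.
    by rewrite mulr_ge0 ?sqr_ge0 // ltW.
  rewrite mulr_ge0 ?divr_ge0 ?sqrtr_ge0 ?(ltW D0) // mulr_ge0 //.
  by rewrite !mulr_ge0 // ltW.
have [d0|d0] := posnP d.
  have dot0 (a b : 'cV[R]_d) : dot a b = 0.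
    by rewrite /dot big1 // => i _; have := leq_trans (ltn_ord i) (eq_leq d0).
  apply: zero_good => w.
    rewrite /excess /huber_objective -sumrB big1 // => i _.
    by rewrite !dot0 subrr.
  by rewrite /xi /score_norm /l2norm dot0 sqrtr0.
have [v0|v_neq0] := eqVneq v 0.
  have tau0 : tau = 0 by rewrite /tau v0 mul0r.
  apply: zero_good => w.
    by rewrite /excess tau0 /huber_objective !big1 ?subrr // => i _; rewrite huber0.
  rewrite /xi tau0 /score_norm big1; first by rewrite scaler0 /l2norm dot0l sqrtr0.
  move=> i _; have -> : huber (0 : R) = cst 0 by apply/funext => u; rewrite huber0.
  by rewrite derive1_cst scale0r.
have v0 : 0 < v by rewrite lt_neqAle eq_sym v_neq0.
have u0 : 0 <= Num.max 0 ups by rewrite le_max lexx.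
have uv := le_powR_of_root delta_ge0 upsv.
pose rho := (d%:R + t) / n%:R; pose q := Num.sqrt rho.
have rho0 : 0 < rho by rewrite divr_gt0.
have rho1 : rho <= 1 by rewrite ler_pdivrMr // mul1r.
have q0 : 0 < q by rewrite sqrtr_gt0.
have qq : q ^+ 2 = rho by rewrite sqr_sqrtr // ltW.
have tauE : tau = v * rho^-1 `^ (2 + delta)^-1 by rewrite /tau /rho invf_div.
have tau0 : 0 < tau.
  by rewrite tauE mulr_gt0 // powR_gt0 // invr_gt0.
have Cq : 2 * C * q <= 1.
  rewrite -(ler_pXn2r (ltn0Sn 1)) ?nnegrE // ?mulr_ge0 ?(ltW C0) ?(ltW q0) //.
  rewrite exprMn qq expr1n /rho mulrA ler_pdivrMr // mul1r.
  apply: le_trans nbig; rewrite ler_wpM2r ?(ltW D0) //.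
  by rewrite exprMn; lra.
have [bad [mbad Pbad] Hbad] := regular_event n0 d0 t0 A0_gt0 delta_ge0 v0 u0 uv rho1
  iid subg (noise_moments_max noise).
have [[symS pdS] _] := inv_sqrtmxP subg.1.
have Sunit := posdefmx_unit (conj symS pdS).
have DE : d%:R + t = q ^+ 2 * n%:R by rewrite qq divfK ?gt_eqF.
have sub : ~` bad `<=` good.
  move=> w /Hbad[Hs Hq Hd].
  rewrite -tauE in Hs Hd.
  have [E1 E2] := wilks_expansion n0 tau0 C10 C20 C30 v0 q0 DE Cq symS Sunit
    (min_hat w) Hs Hq Hd.
  have sn0 : 0 < Num.sqrt (n%:R : R) by rewrite sqrtr_gt0.
  have qE : q = Num.sqrt (d%:R + t) / Num.sqrt n%:R.
    by rewrite /q /rho sqrtrM ?(ltW D0) // sqrtrV // ltW.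
  split.
    apply: le_trans E1 _; rewrite le_eqVlt; apply/orP; left; apply/eqP.
    have -> : (d%:R + t) `^ (3 / 2) = (d%:R + t) * Num.sqrt (d%:R + t).
      rewrite (_ : 3 / 2 = 1 + 2^-1); last by lra.
      rewrite powRD; last by rewrite (gt_eqF D0) implybT.
      by rewrite powRr1 ?(ltW D0) // powR12_sqrt // ltW.
    by rewrite -/C qE; field; rewrite gt_eqF.
  have qD : q * Num.sqrt (d%:R + t) = (d%:R + t) / Num.sqrt n%:R.
    by rewrite qE mulrAC -expr2 sqr_sqrtr ?(ltW D0).
  by move: E2; rewrite qD.
have mE : measurable_fun setT excess.
  apply: measurable_funB; first exact: measurable_objective.
  exact: measurable_minimal_objective.
have mxi : measurable_fun setT xi by exact: measurable_score_norm.
have mgood : measurable good.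
  have -> : good = (setT `&` [set w | `|excess w - 2^-1 * xi w ^+ 2|
      <= C * C1 ^+ 2 * v ^+ 2 * ((d%:R + t) `^ (3 / 2) / Num.sqrt n%:R)]) `&`
     (setT `&` [set w | `|Num.sqrt (2 * excess w) - xi w| <=
       2 * C * C1 * v * ((d%:R + t) / Num.sqrt n%:R)]).
    by rewrite !setTI.
  apply: measurableI; apply: measurable_fun_le => //; apply: measurableT_comp => //.
    apply: measurable_funB => //; apply: measurable_funM => //.
    exact: measurable_funX.
  apply: measurable_funB => //.
  apply: (measurableT_comp (continuous_measurable_fun _)); first exact: sqrt_continuous.
  exact: measurable_funM.
apply: (@le_trans _ _ (P (~` bad))); last first.
  by apply: le_measure => //; rewrite inE //; exact: measurableC.
rewrite probability_setC // EFinB.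
by apply: leeB.
Qed.
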